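(* Let $X_1,X_2,X_3$ be Polish spaces, $\mu_i\in\mathcal{P}(X_i)$, $\mu_{ij}=\mu_i\otimes\mu_j$ for $1\le i<j\le3$, and let $c:X_1\times X_2\times X_3\to[0,\infty)$ be bounded and continuous. Then (a) there is a solution $\{f_{ij}\}$ to the relaxed dual problem with $-17\|c\|_\infty\le f_{ij}(x_i,x_j)\le 13\tfrac13\|c\|_\infty$ for all $(x_i,x_j)$; (b) there is a solution $\{f_{ij}\}$ to the standard dual problem with $-26\tfrac23\|c\|_\infty\le f_{ij}(x_i,x_j)\le 13\tfrac13\|c\|_\infty$ for all $(x_i,x_j)$.
   Context: A measurable set $A\subseteq X=X_1\times X_2\times X_3$ has zero $(3,2)$-thickness if there exist measurable $Y_{ij}\subseteq X_i\times X_j$ with $\mu_{ij}(Y_{ij})=0$ and $A\subseteq\bigcup_{i<j}\{x:(x_i,x_j)\in Y_{ij}\}$. Standard dual problem: maximize $\sum_{i<j}\int f_{ij}\,d\mu_{ij}$ over tuples $f_{ij}\in L^1(\mu_{ij})$ with $f_{12}(x_1,x_2)+f_{13}(x_1,x_3)+f_{23}(x_2,x_3)\le c(x)$ for all $x\in X$. Relaxed dual problem: the same maximization over real-valued $f_{ij}\in L^1(\mu_{ij})$ for which the inequality holds for all $x$ outside a set of zero $(3,2)$-thickness. A solution is a tuple attaining the maximum (both problems have the same supremum). *)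

(* Defs.v *)
From HB Require Import structures.
From mathcomp Require Import all_boot all_order all_algebra.
From mathcomp Require Import all_classical all_reals all_analysis.
Set Implicit Arguments. Unset Strict Implicit. Unset Printing Implicit Defensive.
Import Order.TTheory GRing.Theory Num.Theory numFieldNormedType.Exports.
Local Open Scope classical_set_scope.
Local Open Scope ring_scope.

Notation borel T := (g_sigma_algebraType (@open T)).

Definition polish (R : realType) (T : topologicalType) : Prop :=
  (exists d : T -> T -> R,
    [/\ (forall x y, 0 <= d x y /\ (d x y = 0 <-> x = y)),
        (forall x y, d x y = d y x),
        (forall x y z, d x z <= d x y + d y z),
        (forall A : set T, open A <->
           (forall x, A x -> exists2 e : R, 0 < e & [set y | d x y < e] `<=` A))
      & (forall u : nat -> T,
           (forall e : R, 0 < e -> exists N, forall m n, (N <= m)%N -> (N <= n)%N ->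
              d (u m) (u n) < e) ->
           exists l : T, forall e : R, 0 < e -> exists N, forall n, (N <= n)%N ->
              d (u n) l < e)]) /\
  (exists D : set T, countable D /\ dense D).

Section dual.
Context (R : realType) (T1 T2 T3 : ptopologicalType).
Context (mu1 : probability (borel T1) R) (mu2 : probability (borel T2) R)
        (mu3 : probability (borel T3) R).

Definition mu12 := (mu1 \x mu2)%E.
Definition mu13 := (mu1 \x mu3)%E.
Definition mu23 := (mu2 \x mu3)%E.

Definition XX := (borel T1 * borel T2 * borel T3)%type.

Definition zero_thickness (A : set XX) : Prop :=
  measurable A /\
  exists (Y12 : set (borel T1 * borel T2)) (Y13 : set (borel T1 * borel T3))
         (Y23 : set (borel T2 * borel T3)),
    [/\ measurable Y12 /\ mu12 Y12 = 0%E, measurable Y13 /\ mu13 Y13 = 0%E,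
        measurable Y23 /\ mu23 Y23 = 0%E &
        A `<=` [set x : XX | Y12 (x.1.1, x.1.2) \/ Y13 (x.1.1, x.2) \/
                             Y23 (x.1.2, x.2)]].

Definition dual_tuple := ((borel T1 * borel T2 -> R) *
  (borel T1 * borel T3 -> R) * (borel T2 * borel T3 -> R))%type.

Definition tuple_sum (f : dual_tuple) (x : XX) : R :=
  f.1.1 (x.1.1, x.1.2) + f.1.2 (x.1.1, x.2) + f.2 (x.1.2, x.2).

Definition integrable_tuple (f : dual_tuple) : Prop :=
  [/\ mu12.-integrable setT (EFin \o f.1.1),
      mu13.-integrable setT (EFin \o f.1.2) &
      mu23.-integrable setT (EFin \o f.2)].

Definition dual_value (f : dual_tuple) : \bar R :=
  (\int[mu12]_z (f.1.1 z)%:E + \int[mu13]_z (f.1.2 z)%:E +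
   \int[mu23]_z (f.2 z)%:E)%E.

Definition std_admissible (c : XX -> R) (f : dual_tuple) : Prop :=
  integrable_tuple f /\ forall x, tuple_sum f x <= c x.

Definition relaxed_admissible (c : XX -> R) (f : dual_tuple) : Prop :=
  integrable_tuple f /\
  exists N : set XX, zero_thickness N /\
    forall x, ~ N x -> tuple_sum f x <= c x.

Definition std_solution (c : XX -> R) (f : dual_tuple) : Prop :=
  std_admissible c f /\
  forall g, std_admissible c g -> (dual_value g <= dual_value f)%E.

Definition relaxed_solution (c : XX -> R) (f : dual_tuple) : Prop :=
  relaxed_admissible c f /\
  forall g, relaxed_admissible c g -> (dual_value g <= dual_value f)%E.

Definition tuple_bounded (lo hi : R) (f : dual_tuple) : Prop :=
  [/\ forall z, lo <= f.1.1 z <= hi,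
      forall z, lo <= f.1.2 z <= hi &
      forall z, lo <= f.2 z <= hi].

End dual.

Definition supnorm (T : Type) (R : realType) (c : T -> R) : R :=
  sup [set `|c x| | x in [set: T]].

(* Main.v *)
Require Import Defs.
From HB Require Import structures.
From mathcomp Require Import all_boot all_order all_algebra.
From mathcomp Require Import all_classical all_reals all_analysis.
From mathcomp Require Import measurable_realfun ring lra.
Set Implicit Arguments. Unset Strict Implicit. Unset Printing Implicit Defensive.
Import Order.TTheory GRing.Theory Num.Theory numFieldNormedType.Exports.
Local Open Scope classical_set_scope.
Local Open Scope ring_scope.

(** The spaces are cut into finitely many cells of small diameter plus a tail of
small measure, and [c] is replaced by its supremum over products of cells.
Averaging an admissible tuple over the cells gives an admissible tuple of this
finite problem with the same value.  In the finite problem a near-optimal tuple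
can be bounded directly: since exchanging one slice for another (lowered by
[M = sup c]) cannot increase the value much, all one-variable averages of the sum
[F = f12 + f13 + f23] are at most about [M] below its mean; since no [f12 a b] can
be raised, every pair [(a, b)] extends to a triple where [F] is almost nonnegative.
Redistributing one-variable functions among the [fij] then bounds them by multiples
of [M].  As the mesh tends to 0, near-minimizers of the L2 norm over a decreasing
sequence of convex sets of such bounded tuples converge almost everywhere, and by
continuity of [c] the limit is admissible up to zero thickness, with maximal value.
Lowering it on the exceptional null sets solves the standard problem. *)

(** * The finite problem *)

(** A single point or slice may carry no mass, so changing a tuple there need not affect its value,
    and optimality says nothing pointwise. On cells of positive mass such a change has a definite
    price: once the tolerance is below [M] times the mass of every product of cells, near-optimality
    yields estimates on every cell, with constants that do not depend on the partition. Hence cells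
    of zero mass must be removed first, and the finite problem needs only near-optimal tuples.

    Zero thickness is stricter than being null for the triple product: the exceptional set must be
    covered by null cylinders over pairs. Weak limits of the tuples would directly give the
    constraint only almost everywhere for the triple product. This is why each component has to
    converge almost everywhere on its own pair space, with countably many null sets discarded there.
    In the other direction, averaging over cells integrates null cylinders away, so one finite
    problem bounds the relaxed values as well as the standard ones. *)

Definition avg (R : realType) (I : finType) (w : I -> R) (h : I -> R) : R :=
  \sum_a w a * h a.

Lemma eq_avg (R : realType) (I : finType) (w h h' : I -> R) :
  h =1 h' -> avg w h = avg w h'.
Proof. by move=> e; apply: eq_bigr => a _; rewrite e. Qed.

Lemma avgD (R : realType) (I : finType) (w h h' : I -> R) :
  avg w (fun a => h a + h' a) = avg w h + avg w h'.
Proof. by rewrite -big_split; apply: eq_bigr => a _ /=; rewrite mulrDr. Qed.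

Lemma avgZ (R : realType) (I : finType) (w h : I -> R) (k : R) :
  avg w (fun a => k * h a) = k * avg w h.
Proof. by rewrite mulr_sumr; apply: eq_bigr => a _; rewrite mulrCA. Qed.

Lemma avg_exchange (R : realType) (I J : finType) (w : I -> R) (v : J -> R)
    (h : I -> J -> R) :
  avg w (fun a => avg v (h a)) = avg v (fun b => avg w (h^~ b)).
Proof.
rewrite /avg; under eq_bigr do rewrite mulr_sumr.
rewrite exchange_big; apply: eq_bigr => b _.
by rewrite mulr_sumr; apply: eq_bigr => a _; rewrite mulrCA.
Qed.

Lemma avg_update (R : realType) (I : finType) (w h : I -> R) (a : I) (u : R) :
  avg w (fun x => if x == a then u else h x) = avg w h + w a * (u - h a).
Proof.
rewrite /avg (bigD1 a)//= eqxx [in RHS](bigD1 a)//=.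
under eq_bigr => x /negbTE -> do [].
by ring.
Qed.

Definition weight (R : realType) (I : finType) (w : I -> R) :=
  (forall a, 0 < w a) /\ \sum_a w a = 1.

Lemma avg_cst (R : realType) (I : finType) (w : I -> R) (k : R) :
  weight w -> avg w (fun=> k) = k.
Proof. by move=> [_ w1]; rewrite /avg -mulr_suml w1 mul1r. Qed.

Lemma le_avg (R : realType) (I : finType) (w h h' : I -> R) :
  weight w -> (forall a, h a <= h' a) -> avg w h <= avg w h'.
Proof. by move=> [w0 _] hh; apply: ler_sum => a _; rewrite ler_wpM2l// ltW. Qed.

Lemma avg_le (R : realType) (I : finType) (w h : I -> R) (k : R) :
  weight w -> (forall a, h a <= k) -> avg w h <= k.
Proof. by move=> w0 hk; rewrite -(avg_cst k w0); exact: le_avg. Qed.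

Lemma avg_attained (R : realType) (I : finType) (w h : I -> R) :
  weight w -> exists s, avg w h <= h s.
Proof.
move=> w0; apply: contrapT => /forallNP H.
suff: 0 < avg w (fun a => avg w h + - 1 * h a).
  by rewrite avgD avgZ (avg_cst _ w0) mulN1r subrr ltxx.
case: w0 => w0 w1.
case: (pickP (@predT I)) => [a _|I0]; last first.
  by move/eqP: w1; rewrite (eq_bigl _ _ I0) big_pred0_eq eq_sym oner_eq0.
rewrite /avg (bigD1 a)//=; apply: ltr_pwDl.
  by rewrite mulr_gt0// mulN1r subr_gt0 ltNge; apply/negP/H.
apply: sumr_ge0 => b _; rewrite mulr_ge0 ?(ltW (w0 _))// mulN1r subr_ge0 leNgt.
by apply/negP => /ltW; exact: H.
Qed.

Lemma weight_lb (R : realType) (I : finType) (w : I -> R) :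
  weight w -> exists2 d : R, 0 < d <= 1 & forall a, d <= w a.
Proof.
(* Starting the minimum at 1 gives [d <= 1], so that a product of such bounds lies below each of its
   factors. *)
move=> [w0 w1]; exists (\big[Order.min/1]_a w a); last first.
  by move=> a; exact: bigmin_le_cond.
apply/andP; split; last exact: bigmin_le_id.
by rewrite lt_bigmin// ltr01; apply/allP.
Qed.

Section finite_problem.
Context (R : realType).

Definition fval (I1 I2 I3 : finType) (w1 : I1 -> R) (w2 : I2 -> R)
    (w3 : I3 -> R) (f12 : I1 -> I2 -> R) (f13 : I1 -> I3 -> R)
    (f23 : I2 -> I3 -> R) : R :=
  avg w1 (fun a => avg w2 (f12 a)) + avg w1 (fun a => avg w3 (f13 a)) +
  avg w2 (fun b => avg w3 (f23 b)).

Definition fadm (I1 I2 I3 : finType) (C : I1 -> I2 -> I3 -> R)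
    (f12 : I1 -> I2 -> R) (f13 : I1 -> I3 -> R) (f23 : I2 -> I3 -> R) :=
  forall a b c, f12 a b + f13 a c + f23 b c <= C a b c.

Definition near_opt (I1 I2 I3 : finType) (w1 : I1 -> R) (w2 : I2 -> R)
    (w3 : I3 -> R) (C : I1 -> I2 -> I3 -> R) (t : R) f12 f13 f23 :=
  fadm C f12 f13 f23 /\ forall g12 g13 g23, fadm C g12 g13 g23 ->
    fval w1 w2 w3 g12 g13 g23 <= fval w1 w2 w3 f12 f13 f23 + t.

(** The symmetries of the problem: thanks to them the slice and contact estimates are proved only
    for the first coordinate and the first pair. *)
Lemma fval_swap12 (I1 I2 I3 : finType) (w1 : I1 -> R) (w2 : I2 -> R)
    (w3 : I3 -> R) f12 f13 f23 :
  fval w1 w2 w3 f12 f13 f23 = fval w2 w1 w3 (fun b a => f12 a b) f23 f13.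
Proof. by rewrite /fval (avg_exchange w1 w2) -!addrA [in LHS](addrC (avg w1 _)). Qed.

Lemma fval_swap23 (I1 I2 I3 : finType) (w1 : I1 -> R) (w2 : I2 -> R)
    (w3 : I3 -> R) f12 f13 f23 :
  fval w1 w2 w3 f12 f13 f23 = fval w1 w3 w2 f13 f12 (fun c b => f23 b c).
Proof. by rewrite /fval (avg_exchange w2 w3) [in LHS](addrC (avg w1 _)). Qed.

Lemma near_opt_swap12 (I1 I2 I3 : finType) (w1 : I1 -> R) (w2 : I2 -> R)
    (w3 : I3 -> R) C t f12 f13 f23 :
  near_opt w1 w2 w3 C t f12 f13 f23 ->
  near_opt w2 w1 w3 (fun b a c => C a b c) t (fun b a => f12 a b) f23 f13.
Proof.
move=> [adm opt]; split=> [b a c|g12 g13 g23 gadm]; first by rewrite addrAC adm.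
rewrite -(fval_swap12 w1 w2 w3 f12) (fval_swap12 w2 w1 w3 g12); apply: opt => a b c.
by rewrite addrAC gadm.
Qed.

Lemma near_opt_swap23 (I1 I2 I3 : finType) (w1 : I1 -> R) (w2 : I2 -> R)
    (w3 : I3 -> R) C t f12 f13 f23 :
  near_opt w1 w2 w3 C t f12 f13 f23 ->
  near_opt w1 w3 w2 (fun a c b => C a b c) t f13 f12 (fun c b => f23 b c).
Proof.
move=> [adm opt]; split=> [a c b|g12 g13 g23 gadm].
  by rewrite (addrC (f13 _ _)) adm.
rewrite -(fval_swap23 w1 w2 w3 f12) (fval_swap23 w1 w3 w2 g12); apply: opt => a b c.
by rewrite (addrC (g13 _ _)) gadm.
Qed.

(* Replacing the slice over [a] by the slice over [s], lowered by [M], keeps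
   admissibility because the slice over [s] is at most [M] and [C] is nonnegative. *)
Lemma near_opt_slice (I1 I2 I3 : finType) (w1 : I1 -> R) (w2 : I2 -> R)
    (w3 : I3 -> R) C t f12 f13 f23 (M : R) (a s : I1) :
  weight w2 -> (forall a b c, 0 <= C a b c <= M) ->
  near_opt w1 w2 w3 C t f12 f13 f23 ->
  w1 a * ((avg w2 (f12 s) + avg w3 (f13 s)) - M -
          (avg w2 (f12 a) + avg w3 (f13 a))) <= t.
Proof.
move=> w20 CM [adm opt].
pose g12 x := if x == a then (fun b => f12 s b + - M) else f12 x.
pose g13 x := if x == a then f13 s else f13 x.
have gadm : fadm C g12 g13 f23.
  move=> x b c; rewrite /g12 /g13; case: eqP => [->|_]; last exact: adm.
  have := adm s b c; have /andP[_ ] := CM s b c; have /andP[+ _] := CM a b c; lra.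
have := opt _ _ _ gadm; rewrite /fval.
have -> : avg w1 (fun x => avg w2 (g12 x)) =
    avg w1 (fun x => if x == a then avg w2 (f12 s) - M else avg w2 (f12 x)).
  by apply: eq_avg => x; rewrite /g12; case: eqP => // _; rewrite avgD avg_cst.
have -> : avg w1 (fun x => avg w3 (g13 x)) =
    avg w1 (fun x => if x == a then avg w3 (f13 s) else avg w3 (f13 x)).
  by apply: eq_avg => x; rewrite /g13; case: eqP.
rewrite !avg_update; lra.
Qed.

(** If the sum stayed below [- e] for all [c], raising [f12 a b] by [e] would remain admissible, as
    [C] is nonnegative, and would gain [w1 a * (w2 b * e)], more than the tolerance. *)
Lemma near_opt_contact (I1 I2 I3 : finType) (w1 : I1 -> R) (w2 : I2 -> R)
    (w3 : I3 -> R) C t f12 f13 f23 (e : R) (a : I1) (b : I2) :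
  0 <= e -> t < w1 a * (w2 b * e) -> (forall a b c, 0 <= C a b c) ->
  near_opt w1 w2 w3 C t f12 f13 f23 ->
  exists c, - e <= f12 a b + f13 a c + f23 b c.
Proof.
move=> e0 te C0 [adm opt]; apply: contrapT => /forallNP H.
pose g12 x := if x == a then
  (fun y => if y == b then f12 a b + e else f12 a y) else f12 x.
have gadm : fadm C g12 f13 f23.
  move=> x y c; rewrite /g12; case: eqP => [->|_]; last exact: adm.
  case: eqP => [->|_]; last exact: adm.
  have /negP := H c; rewrite -ltNge; have := C0 a b c; lra.
have := opt _ _ _ gadm; rewrite /fval.
have -> : avg w1 (fun x => avg w2 (g12 x)) =
    avg w1 (fun x => if x == a then avg w2 (f12 a) + w2 b * e else avg w2 (f12 x)).
  apply: eq_avg => x; rewrite /g12; case: eqP => // _.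
  by rewrite avg_update; congr (_ + _ * _); ring.
rewrite !avg_update; have -> : avg w2 (f12 a) + w2 b * e - avg w2 (f12 a) = w2 b * e by ring.
lra.
Qed.

(** The zero tuple is admissible because [C] is nonnegative, and every value is a weighted mean of
    the sum of the tuple, hence at most [M]; so the supremum is finite and can be approached. *)
Lemma near_opt_exists (I1 I2 I3 : finType) (w1 : I1 -> R) (w2 : I2 -> R)
    (w3 : I3 -> R) C (M t : R) :
  weight w1 -> weight w2 -> weight w3 -> (forall a b c, 0 <= C a b c <= M) ->
  0 < t -> exists f12 f13 f23, near_opt w1 w2 w3 C t f12 f13 f23.
Proof.
move=> W1 W2 W3 CM t0.
pose S := [set v | exists g12 g13 g23, fadm C g12 g13 g23 /\
  v = fval w1 w2 w3 g12 g13 g23].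
have hS : has_sup S.
  split.
    exists (fval w1 w2 w3 (fun _ _ => 0) (fun _ _ => 0) (fun _ _ => 0)).
    do 3 eexists; split; last by [].
    by move=> a b c; rewrite !addr0; case/andP: (CM a b c).
  exists M => _ [g12 [g13 [g23 [gadm ->]]]].
  have : avg w1 (fun a => avg w2 (fun b => avg w3 (fun c =>
      g12 a b + g13 a c + g23 b c))) <= M.
    apply: avg_le => // a; apply: avg_le => // b; apply: avg_le => // c.
    by apply: le_trans (gadm a b c) _; case/andP: (CM a b c).
  apply: le_trans; rewrite /fval le_eqVlt; apply/orP; left; apply/eqP.
  under [RHS]eq_avg => a do under eq_avg => b do rewrite 2!avgD (avg_cst _ W3).
  under [RHS]eq_avg => a do rewrite 2!avgD (avg_cst _ W2).
  by rewrite 2!avgD (avg_cst _ W1).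
have [_ [f12 [f13 [f23 [adm ->]]]] fS] := sup_adherent t0 hS.
exists f12, f13, f23; split=> // g12 g13 g23 gadm.
have : fval w1 w2 w3 g12 g13 g23 <= sup S.
  apply: sup_upper_bound => //; by exists g12, g13, g23.
lra.
Qed.

(** For moving one-variable functions [p] and [q] between the members of a tuple: only their means
    enter the value. *)
Lemma avg_gauge (I J : finType) (w : I -> R) (v : J -> R) h p q :
  weight w -> weight v ->
  avg w (fun a => avg v (fun b => h a b + p a + q b)) =
  avg w (fun a => avg v (h a)) + avg w p + avg v q.
Proof.
move=> W V.
under eq_avg => a do rewrite 2!avgD (avg_cst _ V).
by rewrite 2!avgD (avg_cst _ W).
Qed.

(* Write [F] for the sum of a near-optimal tuple [g] and [F12], [F1], ..., [F0] for
   its partial averages.  [near_opt_slice] gives [F1 >= F0 - 2 M] and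
   [near_opt_contact] gives, for all [a] and [b], some [c] with [F a b c >= - M];
   expanding [F a b c] in partial averages then bounds [F12 a b] below.  The tuple
   [F12 - F1 / 2 - F2 / 2 + F0 / 3], and so on, has the same sum [F]. *)
Lemma finite_bounded (I1 I2 I3 : finType) (w1 : I1 -> R) (w2 : I2 -> R)
    (w3 : I3 -> R) C (M t : R) :
  weight w1 -> weight w2 -> weight w3 -> (forall a b c, 0 <= C a b c <= M) ->
  0 < M -> 0 < t ->
  exists f12 f13 f23, near_opt w1 w2 w3 C t f12 f13 f23 /\
   [/\ forall a b, - 17 * M <= f12 a b <= 40 / 3 * M,
       forall a c, - 17 * M <= f13 a c <= 40 / 3 * M &
       forall b c, - 17 * M <= f23 b c <= 40 / 3 * M].
Proof.
move=> W1 W2 W3 CM M0 t0.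
have [d1 /andP[d10 d11] dw1] := weight_lb W1.
have [d2 /andP[d20 d21] dw2] := weight_lb W2.
have [d3 /andP[d30 d31] dw3] := weight_lb W3.
pose d := d1 * d2 * d3.
have d0 : 0 < d by rewrite !mulr_gt0.
have mul_le2 (x y x' y' : R) : 0 < x -> 0 < y -> x <= x' -> y <= y' -> x * y <= x' * y'.
  by move=> x0 y0 xx yy; apply: ler_pM => //; exact: ltW.
have dd12 a b : d <= w1 a * w2 b.
  rewrite -[leRHS]mulr1; apply: (mul_le2) => //; first by rewrite mulr_gt0.
  exact: (mul_le2).
have dd13 a c : d <= w1 a * w3 c.
  by rewrite -[w1 a]mulr1; apply: (mul_le2) => //; [rewrite mulr_gt0|exact: (mul_le2)].
have dd23 b c : d <= w2 b * w3 c.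
  by rewrite -[w2 b]mul1r; apply: (mul_le2) => //; [rewrite mulr_gt0|exact: (mul_le2)].
have dle1 : d <= d1.
  by rewrite /d -mulrA ler_piMr ?(ltW d10)// mulr_ile1 // ltW.
have dle2 : d <= d2.
  by rewrite /d [d1 * _]mulrC -mulrA ler_piMr ?(ltW d20)// mulr_ile1 // ltW.
have dle3 : d <= d3.
  by rewrite /d ler_piMl ?(ltW d30)// mulr_ile1 // ltW.
(* Since [d] bounds every single and every pairwise weight from below, [s < M * d] makes a gain of
   [M] on any slice or any pair of cells exceed the tolerance. *)
pose s := Num.min t (M * d / 2).
have Md0 : 0 < M * d by rewrite mulr_gt0.
have s0 : 0 < s by rewrite lt_min t0 divr_gt0.
have st : s <= t by rewrite ge_min lexx.
have sMd : s < M * d.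
  apply: (@le_lt_trans _ _ (M * d / 2)); first by rewrite ge_min lexx orbT.
  lra.
have [g12 [g13 [g23 opt]]] := near_opt_exists W1 W2 W3 CM s0.
have C0 a b c : 0 <= C a b c by case/andP: (CM a b c).
have contact_lt (u v : R) : d <= u * v -> s < u * (v * M).
  by move=> duv; apply: lt_le_trans sMd _; rewrite mulrA mulrC ler_wpM2r// ltW.
have slice_lt (u x : R) : d <= u -> u * x <= s -> x <= M.
  move=> du ux; rewrite leNgt; apply/negP => Mx.
  have : M * d <= u * x by rewrite mulrC; apply: ler_pM => //; exact: ltW.
  lra.
(* [opt'] brings the second coordinate to the front, [opt''] the third. *)
have opt' := near_opt_swap12 opt.
have opt'' := near_opt_swap12 (near_opt_swap23 opt).
pose F a b c := g12 a b + g13 a c + g23 b c.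
have FM a b c : F a b c <= M.
  by case: opt => adm _; apply: le_trans (adm a b c) _; case/andP: (CM a b c).
pose p12 a := avg w2 (g12 a); pose p13 a := avg w3 (g13 a).
pose p21 b := avg w1 (g12^~ b); pose p23 b := avg w3 (g23 b).
pose p31 c := avg w1 (g13^~ c); pose p32 c := avg w2 (g23^~ c).
pose m12 := avg w1 p12; pose m13 := avg w1 p13; pose m23 := avg w2 p23.
have m12E : m12 = avg w2 p21 by rewrite /m12 avg_exchange.
have m13E : m13 = avg w3 p31 by rewrite /m13 avg_exchange.
have m23E : m23 = avg w3 p32 by rewrite /m23 avg_exchange.
pose F0 := m12 + m13 + m23.
(* Comparison with the zero tuple, whose value is 0. *)
have F0ge : - M <= F0.
  have := opt.2 (fun _ _ => 0) (fun _ _ => 0) (fun _ _ => 0).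
  rewrite {1}/fval !avg_cst// !addr0 -/F0 => H.
  have : s <= M.
    apply: ltW; apply: (lt_le_trans sMd); rewrite ler_piMr ?(ltW M0)//.
    exact: le_trans dle1 _.
  have : 0 <= F0 + s by apply: H => a b c; rewrite !addr0.
  lra.
pose F12 a b := g12 a b + p13 a + p23 b.
pose F13 a c := p12 a + g13 a c + p32 c.
pose F23 b c := p21 b + p31 c + g23 b c.
have F12M a b : F12 a b <= M.
  have : avg w3 (F a b) <= M by apply: avg_le.
  by rewrite /F 2!avgD avg_cst.
have F13M a c : F13 a c <= M.
  have : avg w2 (fun b => F a b c) <= M by apply: avg_le.
  by rewrite /F 2!avgD avg_cst.
have F23M b c : F23 b c <= M.
  have : avg w1 (fun a => F a b c) <= M by apply: avg_le.
  by rewrite /F 2!avgD avg_cst.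
pose F1 a := p12 a + p13 a + m23.
pose F2 b := p21 b + m13 + p23 b.
pose F3 c := m12 + p31 c + p32 c.
have F1M a : F1 a <= M.
  have : avg w2 (F12 a) <= M by apply: avg_le.
  by rewrite /F12 2!avgD avg_cst.
have F2M b : F2 b <= M.
  have : avg w1 (fun a => F12 a b) <= M by apply: avg_le.
  by rewrite /F12 2!avgD avg_cst.
have F3M c : F3 c <= M.
  have : avg w1 (fun a => F13 a c) <= M by apply: avg_le.
  by rewrite /F13 2!avgD avg_cst.
have F0M : F0 <= M.
  have : avg w1 F1 <= M by apply: avg_le.
  by rewrite /F1 2!avgD avg_cst.
(* Some slice [x] is at least as good as the mean [F0]. Exchanging [a] for [x] loses one [M] by the
   lowering and another through the tolerance. *)
have F1ge a : F0 - 2 * M <= F1 a.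
  have [x] := avg_attained F1 W1; rewrite /F1 2!avgD avg_cst// -/F0 => Fx.
  have := near_opt_slice a x W2 CM opt.
  move/(slice_lt _ _ (le_trans dle1 (dw1 a))); rewrite -/(p12 _) -/(p13 _) -/(p12 _) -/(p13 _).
  by move: Fx; rewrite /F0 /F1 /m12 /m13; lra.
have F2ge b : F0 - 2 * M <= F2 b.
  have [x] := avg_attained F2 W2; rewrite /F2 2!avgD avg_cst// -m12E -/F0 => Fx.
  have := near_opt_slice b x W1 (fun _ _ _ => CM _ _ _) opt'.
  move/(slice_lt _ _ (le_trans dle2 (dw2 b))); rewrite -/(p21 _) -/(p23 _) -/(p21 _) -/(p23 _).
  by move: Fx; rewrite /F0 /F2 /m23; lra.
have F3ge c : F0 - 2 * M <= F3 c.
  have [x] := avg_attained F3 W3; rewrite /F3 2!avgD avg_cst// -m13E -m23E -/F0 => Fx.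
  have := near_opt_slice c x W1 (fun _ _ _ => CM _ _ _) opt''.
  move/(slice_lt _ _ (le_trans dle3 (dw3 c))); rewrite -/(p31 _) -/(p32 _) -/(p31 _) -/(p32 _).
  by move: Fx; rewrite /F0 /F3; lra.
(* From [F = F12 + F13 + F23 - F1 - F2 - F3 + F0] at a contact point: [F12 >= - M - 2 M + 3 (F0 - 2
   M) - F0 = 2 F0 - 9 M], and [F0 >= - M]. *)
have F12ge a b : - 11 * M <= F12 a b.
  have [c] := near_opt_contact (ltW M0) (contact_lt _ _ (dd12 a b)) C0 opt.
  have := F13M a c; have := F23M b c; have := F1ge a; have := F2ge b; have := F3ge c.
  by move: F0ge; rewrite /F12 /F13 /F23 /F1 /F2 /F3 /F0; lra.
have F13ge a c : - 11 * M <= F13 a c.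
  have [b] := near_opt_contact (ltW M0) (contact_lt _ _ (dd13 a c))
    (fun _ _ _ => C0 _ _ _) (near_opt_swap23 opt).
  have := F12M a b; have := F23M b c; have := F1ge a; have := F2ge b; have := F3ge c.
  by move: F0ge; rewrite /F12 /F13 /F23 /F1 /F2 /F3 /F0; lra.
have F23ge b c : - 11 * M <= F23 b c.
  have [a] := near_opt_contact (ltW M0) (contact_lt _ _ (dd23 b c))
    (fun _ _ _ => C0 _ _ _) (near_opt_swap23 opt').
  have := F12M a b; have := F13M a c; have := F1ge a; have := F2ge b; have := F3ge c.
  by move: F0ge; rewrite /F12 /F13 /F23 /F1 /F2 /F3 /F0; lra.
(* These functions in fact lie between [- 37/3 M] and [11/3 M]: below, [- 11 M - M + F0 / 3]; above,
   [M - (F0 - 2 M) + F0 / 3]. *)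
exists (fun a b => g12 a b + (p13 a - F1 a / 2 + F0 / 3) + (p23 b - F2 b / 2)).
exists (fun a c => g13 a c + (p12 a - F1 a / 2 + F0 / 3) + (p32 c - F3 c / 2)).
exists (fun b c => g23 b c + (p21 b - F2 b / 2 + F0 / 3) + (p31 c - F3 c / 2)).
split; last first.
  split=> x y.
  - have := F12ge x y; have := F12M x y; have := F1ge x; have := F2ge y.
    have := F1M x; have := F2M y; rewrite /F12; move: F0ge F0M M0; lra.
  - have := F13ge x y; have := F13M x y; have := F1ge x; have := F3ge y.
    have := F1M x; have := F3M y; rewrite /F13; move: F0ge F0M M0; lra.
  - have := F23ge x y; have := F23M x y; have := F2ge x; have := F3ge y.
    have := F2M x; have := F3M y; rewrite /F23; move: F0ge F0M M0; lra.
case: opt => adm optv; split.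
  move=> a b c; apply: le_trans (adm a b c).
  by rewrite le_eqVlt; apply/orP; left; apply/eqP; rewrite /F0 /F1 /F2 /F3; field.
move=> h12 h13 h23 /optv; move/le_trans; apply.
suff <- : fval w1 w2 w3 g12 g13 g23 = fval w1 w2 w3
  (fun a b => g12 a b + (p13 a - F1 a / 2 + F0 / 3) + (p23 b - F2 b / 2))
  (fun a c => g13 a c + (p12 a - F1 a / 2 + F0 / 3) + (p32 c - F3 c / 2))
  (fun b c => g23 b c + (p21 b - F2 b / 2 + F0 / 3) + (p31 c - F3 c / 2)).
  by rewrite lerD2l.
rewrite /fval !avg_gauge//.
have half (I : finType) (w p q : I -> R) (k : R) : weight w ->
    avg w (fun a => p a - q a / 2 + k) = avg w p - avg w q / 2 + k.
  move=> W; rewrite 2!avgD avg_cst//; congr (_ + _ + _).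
  by under eq_avg => a do rewrite -mulrN mulrC; rewrite avgZ; field.
have half' (I : finType) (w p q : I -> R) : weight w ->
    avg w (fun a => p a - q a / 2) = avg w p - avg w q / 2.
  by move=> W; rewrite -[RHS]addr0 -half//; apply: eq_avg => a; rewrite addr0.
rewrite !half// !half'// -/m12 -/m13 -/m23 -m12E -m13E -m23E.
have -> : avg w1 F1 = F0 by rewrite /F1 2!avgD avg_cst.
have -> : avg w2 F2 = F0 by rewrite /F2 2!avgD avg_cst// -m12E.
have -> : avg w3 F3 = F0 by rewrite /F3 2!avgD avg_cst// -m13E -m23E.
by rewrite -/(p12) -/(p13) -/(p23); rewrite /F0; field.
Qed.

End finite_problem.

(** * Restriction, conditioning and pushforward of measures *)

Section measure_tools.
Context (R : realType).

Lemma RintegralE d (T : measurableType d) (m : measure T R) (f : T -> R) :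
  m.-integrable setT (EFin \o f) ->
  (\int[m]_x (f x)%:E)%E = (\int[m]_x f x)%:E.
Proof. by move=> mf; rewrite /Rintegral fineK// integrable_fin_num. Qed.

(** The hypothesis says that [n] is [m] conditioned on [B], a set of mass [k] when [n] is a
    probability. Both sides are integrals against [mrestr m mB], for which the complement of [B] is
    null. *)
Lemma ge0_integral_restr_scale d (T : measurableType d) (m n : measure T R)
    (B : set T) (k : R) (f : T -> \bar R) :
  measurable B -> 0 < k ->
  (forall S, measurable S -> m (S `&` B) = (k%:E * n S)%E) ->
  measurable_fun setT f -> (forall x, (0 <= f x)%E) ->
  (\int[m]_(x in B) f x = k%:E * \int[n]_x f x)%E.
Proof.
move=> mB k0 mn mf f0.
rewrite -[k]/((NngNum (ltW k0))%:num) -ge0_integral_mscale//.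
transitivity (\int[mrestr m mB]_x f x)%E; last first.
  by apply: eq_measure_integral => S mS _; exact: mn.
have mBC : measurable (~` B) by exact: measurableC.
rewrite (@ge0_negligible_integral _ _ _ (mrestr m mB) setT (~` B))//; last first.
  by rewrite /= /mrestr setICl measure0.
rewrite setTD setCK; apply: eq_measure_integral => S mS SB.
by rewrite /= /mrestr setIidl.
Qed.

Lemma integral_restr_scale d (T : measurableType d) (m n : measure T R)
    (B : set T) (k : R) (f : T -> R) :
  measurable B -> 0 < k ->
  (forall S, measurable S -> m (S `&` B) = (k%:E * n S)%E) ->
  m.-integrable setT (EFin \o f) ->
  n.-integrable setT (EFin \o f) /\
  \int[m]_(x in B) f x = k * \int[n]_x f x.
Proof.
move=> mB k0 mn mf; have mfm := measurable_int _ mf.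
have mfB : m.-integrable B (EFin \o f) by exact: integrableS mf.
have nf : n.-integrable setT (EFin \o f).
  apply/integrableP; split=> //.
  have := integrableP _ _ _ mfB => -[_].
  rewrite (@ge0_integral_restr_scale _ _ m n B k)//; last exact: measurableT_comp.
  rewrite !ltey; apply: contra_neq => ->.
  by rewrite gt0_muley// lte_fin.
split; first exact: nf.
rewrite /Rintegral (integralE m) (integralE n).
have nfp := integrable_pos_fin_num measurableT nf.
have nfn := integrable_neg_fin_num measurableT nf.
rewrite (@ge0_integral_restr_scale _ _ m n B k)//; last exact: measurable_funepos.
rewrite (@ge0_integral_restr_scale _ _ m n B k)//; last exact: measurable_funeneg.
rewrite -muleBr//; last exact: fin_num_adde_defr.
by rewrite fineM// fin_numB nfp nfn.
Qed.

Lemma pushforward_integral d d' (X : measurableType d) (Y : measurableType d')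
    (m : measure X R) (n : measure Y R) (phi : X -> Y) (f : Y -> R) :
  measurable_fun setT phi ->
  (forall S, measurable S -> n S = m (phi @^-1` S)) ->
  n.-integrable setT (EFin \o f) ->
  m.-integrable setT (EFin \o (f \o phi)) /\
  \int[m]_x f (phi x) = \int[n]_y f y.
Proof.
move=> mphi nm nf; have mf := measurable_int _ nf.
have mi : m.-integrable setT (EFin \o (f \o phi)).
  apply/integrableP; split.
    by rewrite -[_ \o _]/((EFin \o f) \o phi); exact: measurableT_comp mf mphi.
  have /integrableP[_] := nf; apply: le_lt_trans; rewrite le_eqVlt; apply/orP; left.
  apply/eqP.
  rewrite (eq_measure_integral (pushforward m phi))//; last by move=> S mS _; exact: nm.
  rewrite (@ge0_integral_pushforward _ _ _ _ _ phi mphi m setT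
    (fun y => `|(f y)%:E|%E))//.
  exact: measurableT_comp.
split; first exact: mi.
rewrite /Rintegral; congr fine.
rewrite (eq_measure_integral (pushforward m phi) (m1 := n))//; last by move=> S mS _; exact: nm.
by rewrite (@integral_pushforward _ _ _ _ _ phi mphi m setT (EFin \o f)).
Qed.

Lemma conditional_probability d (T : measurableType d) (P : probability T R)
    (A : set T) (w : R) : measurable A -> 0 < w -> P A = w%:E ->
  exists Q : probability T R, forall S, measurable S ->
    P (S `&` A) = (w%:E * Q S)%E.
Proof.
move=> mA w0 PA.
exists (mnormalize (mrestr P mA) P) => S mS.
have PT : mrestr P mA setT = w%:E by rewrite /mrestr setTI.
rewrite /= /mnormalize /= PT eqe (gt_eqF w0)/= /mrestr.
by rewrite muleCA -EFinM divff ?mule1// gt_eqF.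
Qed.

(** Conditioning commutes with products: the rescaled restriction agrees with [n1 \x n2] on
    rectangles, and these determine a product measure. *)
Lemma product_conditional d1 d2 (T1 : measurableType d1) (T2 : measurableType d2)
    (m1 n1 : probability T1 R) (m2 n2 : probability T2 R) A B (w v : R) :
  measurable A -> measurable B -> 0 < w -> 0 < v ->
  (forall S, measurable S -> m1 (S `&` A) = (w%:E * n1 S)%E) ->
  (forall S, measurable S -> m2 (S `&` B) = (v%:E * n2 S)%E) ->
  forall S, measurable S ->
    (m1 \x m2)%E (S `&` (A `*` B)) = ((w * v)%:E * (n1 \x n2) S)%E.
Proof.
move=> mA mB w0 v0 mn1 mn2 S mS.
have k0 : 0 <= (w * v)^-1 by rewrite invr_ge0 mulr_ge0// ltW.
have mAB : measurable (A `*` B) by exact: measurableX.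
rewrite (@product_measure_unique _ _ _ _ _ n1 n2
  (mscale (NngNum k0) (mrestr (m1 \x m2)%E mAB)))//.
  rewrite /mscale/= /mrestr muleA -EFinM divff ?mul1e//.
  by rewrite mulf_neq0// gt_eqF.
move=> C D mC mD; rewrite /= /mscale/= /mrestr -setXI product_measure1E//; try exact: measurableI.
transitivity ((w * v)^-1%:E * ((w%:E * n1 C) * (v%:E * n2 D)))%E.
  by congr (_ * (_ * _))%E; [exact: mn1|exact: mn2].
rewrite muleACA -EFinM [LHS]muleA -EFinM.
by rewrite mulVf ?mul1e// mulf_neq0// gt_eqF.
Qed.

End measure_tools.

(** * Averages over cells *)

Section cells.
Context (R : realType) d1 d2 d3 (U1 : measurableType d1) (U2 : measurableType d2)
  (U3 : measurableType d3).

Definition pr12 (x : U1 * U2 * U3) : U1 * U2 := (x.1.1, x.1.2).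
Definition pr13 (x : U1 * U2 * U3) : U1 * U3 := (x.1.1, x.2).
Definition pr23 (x : U1 * U2 * U3) : U2 * U3 := (x.1.2, x.2).

Lemma measurable_pr12 : measurable_fun setT pr12.
Proof.
apply/measurable_fun_pairP; split.
  exact: (measurableT_comp measurable_fst measurable_fst).
exact: (measurableT_comp measurable_snd measurable_fst).
Qed.

Lemma measurable_pr13 : measurable_fun setT pr13.
Proof.
apply/measurable_fun_pairP; split; last exact: measurable_snd.
exact: (measurableT_comp measurable_fst measurable_fst).
Qed.

Lemma measurable_pr23 : measurable_fun setT pr23.
Proof.
apply/measurable_fun_pairP; split; last exact: measurable_snd.
exact: (measurableT_comp measurable_snd measurable_fst).
Qed.

Context (n1 : probability U1 R) (n2 : probability U2 R) (n3 : probability U3 R).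
Let m : measure _ R := ((n1 \x n2) \x n3)%E.

Let mE A B D : measurable A -> measurable B -> measurable D ->
  m ((A `*` B) `*` D) = (n1 A * n2 B * n3 D)%E.
Proof.
move=> mA mB mD; rewrite /m /= product_measure1E//; last exact: measurableX.
by congr (_ * _)%E; exact: product_measure1E.
Qed.

Lemma product_pr12 S : measurable S -> (n1 \x n2)%E S = m (pr12 @^-1` S).
Proof.
move=> mS; have -> : pr12 @^-1` S = S `*` setT.
  by apply/seteqP; split=> -[[x y] z] //= [].
rewrite /m /= product_measure1E// -[LHS]mule1.
by congr (_ * _)%E; exact/esym/probability_setT.
Qed.

(** Unlike for [pr12], the preimage of a measurable set is not a rectangle of the left-nested
    product, so the pushforward is identified through its values on rectangles. *)
Lemma product_pr13 S : measurable S -> (n1 \x n3)%E S = m (pr13 @^-1` S).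
Proof.
move=> mS.
have mphi := measurable_pr13.
rewrite (product_measure_unique (m1 := n1) (m2 := n3) (m' := pushforward m pr13))//.
move=> A D mA mD; rewrite /= /pushforward.
have -> : pr13 @^-1` (A `*` D) = (A `*` setT) `*` D.
  by apply/seteqP; split=> -[[x y] z] //=; rewrite /pr13/=; tauto.
by rewrite mE// probability_setT mule1.
Qed.

Lemma product_pr23 S : measurable S -> (n2 \x n3)%E S = m (pr23 @^-1` S).
Proof.
move=> mS.
have mphi := measurable_pr23.
rewrite (product_measure_unique (m1 := n2) (m2 := n3) (m' := pushforward m pr23))//.
move=> A D mA mD; rewrite /= /pushforward.
have -> : pr23 @^-1` (A `*` D) = (setT `*` A) `*` D.
  by apply/seteqP; split=> -[[x y] z] //=; rewrite /pr23/=; tauto.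
by rewrite mE// probability_setT mul1e.
Qed.

(** Each integral is lifted to the triple product, where the three cylinders are null; there the
    inequality holds almost everywhere and is integrated against a probability. *)
Lemma sum_integral_le f12 f13 f23 (C : R) Y12 Y13 Y23 :
  (n1 \x n2)%E.-integrable setT (EFin \o f12) ->
  (n1 \x n3)%E.-integrable setT (EFin \o f13) ->
  (n2 \x n3)%E.-integrable setT (EFin \o f23) ->
  measurable Y12 -> measurable Y13 -> measurable Y23 ->
  (n1 \x n2)%E Y12 = 0%E -> (n1 \x n3)%E Y13 = 0%E -> (n2 \x n3)%E Y23 = 0%E ->
  (forall x, ~ Y12 (pr12 x) -> ~ Y13 (pr13 x) -> ~ Y23 (pr23 x) ->
     f12 (pr12 x) + f13 (pr13 x) + f23 (pr23 x) <= C) ->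
  \int[(n1 \x n2)%E]_z f12 z + \int[(n1 \x n3)%E]_z f13 z +
  \int[(n2 \x n3)%E]_z f23 z <= C.
Proof.
move=> i12 i13 i23 mY12 mY13 mY23 Y120 Y130 Y230 fC.
have [j12 <-] := pushforward_integral measurable_pr12 product_pr12 i12.
have [j13 <-] := pushforward_integral measurable_pr13 product_pr13 i13.
have [j23 <-] := pushforward_integral measurable_pr23 product_pr23 i23.
rewrite -RintegralD// -RintegralD//; last first.
  by apply: eq_integrable (integrableD _ j12 j13) => //.
set F := (X in \int[_]_x X x).
pose N := pr12 @^-1` Y12 `|` (pr13 @^-1` Y13 `|` pr23 @^-1` Y23).
have mN12 : measurable (pr12 @^-1` Y12).
  by rewrite -[X in measurable X]setTI; exact: measurable_pr12.
have mN13 : measurable (pr13 @^-1` Y13).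
  by rewrite -[X in measurable X]setTI; exact: measurable_pr13.
have mN23 : measurable (pr23 @^-1` Y23).
  by rewrite -[X in measurable X]setTI; exact: measurable_pr23.
have mN : measurable N by apply: measurableU => //; exact: measurableU.
have N0 : m N = 0%E.
  rewrite /N measureU0//; first by rewrite -product_pr12.
    exact: measurableU.
  by rewrite measureU0//; rewrite -?product_pr13 -?product_pr23.
have iF : m.-integrable setT (EFin \o F).
  have := integrableD measurableT (integrableD measurableT j12 j13) j23.
  exact: eq_integrable.
have mT : m setT = 1%E.
  by rewrite -!setXTT mE// !probability_setT !mule1.
have ic : m.-integrable setT (EFin \o cst C).
  by apply: measurable_bounded_integrable => //; rewrite ?mT ?ltry//; exact: bounded_cst.
rewrite -lee_fin -(RintegralE iF).
rewrite (negligible_integral mN measurableT iF N0).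
have -> : C%:E = (\int[m]_(x in setT `\` N) C%:E)%E.
  rewrite -(negligible_integral mN measurableT ic N0).
  by rewrite (integral_cst m measurableT C%:E) mT mule1.
have mD : measurable (setT `\` N) by exact: measurableD.
apply: le_integral => //; [exact: integrableS iF|exact: integrableS ic|].
move=> x; rewrite inE => -[_ Nx]; rewrite lee_fin; apply: fC => Y; apply: Nx.
- by left.
- by right; left.
- by right; right.
Qed.

End cells.

(** The complement of the cell is null for the conditioned measure. Adding it to the exceptional set
    lets an inequality known only on the cell be used as if known everywhere. *)
Lemma null_conditional d (T : measurableType d) (R : realType) (m n : measure T R)
    (B Y : set T) (k : R) :
  measurable B -> measurable Y -> 0 < k ->
  (forall S, measurable S -> m (S `&` B) = (k%:E * n S)%E) ->
  m Y = 0%E -> measurable (Y `|` ~` B) /\ n (Y `|` ~` B) = 0%E.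
Proof.
move=> mB mY k0 mn Y0.
have mS : measurable (Y `|` ~` B) by apply: measurableU => //; exact: measurableC.
split=> //; apply/eqP.
have : m ((Y `|` ~` B) `&` B) = 0%E.
  apply/eqP; rewrite -measure_le0 -Y0; apply: le_measure; rewrite ?inE//.
    exact: measurableI.
  by move=> x [[//|nB] Bx].
by rewrite mn// => /eqP; rewrite mule_eq0 eqe (gt_eqF k0).
Qed.

(** The three terms are integrals against the measures conditioned on [A1], [A2] and [A3], to which
    [sum_integral_le] applies. *)
Lemma cell_average_le (R : realType) d1 d2 d3 (U1 : measurableType d1)
    (U2 : measurableType d2) (U3 : measurableType d3)
    (m1 : probability U1 R) (m2 : probability U2 R) (m3 : probability U3 R)
    f12 f13 f23 Y12 Y13 Y23 (A1 : set U1) (A2 : set U2) (A3 : set U3)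
    (w1 w2 w3 C : R) :
  (m1 \x m2)%E.-integrable setT (EFin \o f12) ->
  (m1 \x m3)%E.-integrable setT (EFin \o f13) ->
  (m2 \x m3)%E.-integrable setT (EFin \o f23) ->
  measurable Y12 -> measurable Y13 -> measurable Y23 ->
  (m1 \x m2)%E Y12 = 0%E -> (m1 \x m3)%E Y13 = 0%E -> (m2 \x m3)%E Y23 = 0%E ->
  measurable A1 -> measurable A2 -> measurable A3 ->
  0 < w1 -> 0 < w2 -> 0 < w3 ->
  m1 A1 = w1%:E -> m2 A2 = w2%:E -> m3 A3 = w3%:E ->
  (forall x, A1 x.1.1 -> A2 x.1.2 -> A3 x.2 ->
     ~ Y12 (pr12 x) -> ~ Y13 (pr13 x) -> ~ Y23 (pr23 x) ->
     f12 (pr12 x) + f13 (pr13 x) + f23 (pr23 x) <= C) ->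
  (w1 * w2)^-1 * \int[(m1 \x m2)%E]_(z in A1 `*` A2) f12 z +
  (w1 * w3)^-1 * \int[(m1 \x m3)%E]_(z in A1 `*` A3) f13 z +
  (w2 * w3)^-1 * \int[(m2 \x m3)%E]_(z in A2 `*` A3) f23 z <= C.
Proof.
move=> i12 i13 i23 mY12 mY13 mY23 Y120 Y130 Y230 mA1 mA2 mA3 w10 w20 w30.
move=> m1A m2A m3A fC.
have [n1 mn1] := conditional_probability mA1 w10 m1A.
have [n2 mn2] := conditional_probability mA2 w20 m2A.
have [n3 mn3] := conditional_probability mA3 w30 m3A.
have mn12 := product_conditional mA1 mA2 w10 w20 mn1 mn2.
have mn13 := product_conditional mA1 mA3 w10 w30 mn1 mn3.
have mn23 := product_conditional mA2 mA3 w20 w30 mn2 mn3.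
have k12 : 0 < w1 * w2 by rewrite mulr_gt0.
have k13 : 0 < w1 * w3 by rewrite mulr_gt0.
have k23 : 0 < w2 * w3 by rewrite mulr_gt0.
have m12 : measurable (A1 `*` A2) by exact: measurableX.
have m13 : measurable (A1 `*` A3) by exact: measurableX.
have m23 : measurable (A2 `*` A3) by exact: measurableX.
have [j12 ->] := integral_restr_scale m12 k12 mn12 i12.
have [j13 ->] := integral_restr_scale m13 k13 mn13 i13.
have [j23 ->] := integral_restr_scale m23 k23 mn23 i23.
rewrite !mulKf ?gt_eqF//.
have [mZ12 Z12] := null_conditional m12 mY12 k12 mn12 Y120.
have [mZ13 Z13] := null_conditional m13 mY13 k13 mn13 Y130.
have [mZ23 Z23] := null_conditional m23 mY23 k23 mn23 Y230.
apply: (sum_integral_le j12 j13 j23 mZ12 mZ13 mZ23 Z12 Z13 Z23).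
move=> x /not_orP[y12 /contrapT[a1 a2]] /not_orP[y13 /contrapT[_ a3]] /not_orP[y23 _].
exact: fC.
Qed.

Lemma bounded_integrable (R : realType) d (T : measurableType d)
    (m : measure T R) (f : T -> R) (B : R) :
  m setT = 1%E -> measurable_fun setT f -> (forall x, `|f x| <= B) ->
  m.-integrable setT (EFin \o f).
Proof.
move=> mT mf fB; apply: measurable_bounded_integrable => //.
  by rewrite mT ltry.
exists B; split; first exact: num_real.
by move=> x Bx y _ /=; exact: le_trans (fB y) (ltW Bx).
Qed.

Lemma product_setT (R : realType) d1 d2 (T1 : measurableType d1)
    (T2 : measurableType d2) (m1 : probability T1 R) (m2 : probability T2 R) :
  (m1 \x m2)%E setT = 1%E.
Proof.
rewrite -setXTT product_measure1E// -[RHS]mule1.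
by congr (_ * _)%E; exact: probability_setT.
Qed.

Lemma preimage_cell (T : Type) (K : finType) (r : T -> K) :
  \big[setU/set0]_(k <- index_enum K) (r @^-1` [set k]) = setT.
Proof.
apply/seteqP; split=> // x _; rewrite -bigcup_seq.
by exists (r x) => //=; rewrite mem_index_enum.
Qed.

Lemma Rintegral_partition (R : realType) d (T : measurableType d)
    (m : measure T R) (K : finType) (r : T -> K) (f : T -> R) :
  (forall k, measurable (r @^-1` [set k])) ->
  m.-integrable setT (EFin \o f) ->
  \int[m]_x f x = \sum_k \int[m]_(x in r @^-1` [set k]) f x.
Proof.
move=> mr mf; apply: EFin_inj; rewrite -RintegralE// -sumEFin.
have H := @integral_bigsetU_EFin _ _ _ m K (fun k => r @^-1` [set k]) f
  (index_enum K) mr (index_enum_uniq K).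
rewrite -[in LHS](preimage_cell r) H.
- apply: eq_bigr => k _; rewrite /Rintegral fineK//; apply: integrable_fin_num => //.
  exact: integrableS mf.
- by apply/trivIsetP => i j _ _ /eqP ij; apply/seteqP; split=> // x [/= ri rj]; apply: ij; rewrite -ri -rj.
- by rewrite preimage_cell; exact: measurable_int mf.
Qed.

Lemma measurable_fun_finite d d' (T : measurableType d) (T' : measurableType d')
    (K : finType) (r : T -> K) (h : K -> T') :
  (forall k, measurable (r @^-1` [set k])) -> measurable_fun setT (h \o r).
Proof.
move=> mr _ Y mY; rewrite setTI.
have -> : (h \o r) @^-1` Y = \bigcup_(k in [set k | Y (h k)]) (r @^-1` [set k]).
  by apply/seteqP; split=> x /=; [move=> ?; exists (r x)|move=> [k /= ? ->]].
by apply: fin_bigcup_measurable => //; exact: finite_finset.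
Qed.

Section cells.
Context (R : realType) d1 d2 (U1 : measurableType d1) (U2 : measurableType d2)
  (m1 : probability U1 R) (m2 : probability U2 R) (I1 I2 : finType)
  (p1 : U1 -> I1) (p2 : U2 -> I2) (w1 : I1 -> R) (w2 : I2 -> R).
Hypothesis mp1 : forall a, measurable (p1 @^-1` [set a]).
Hypothesis mp2 : forall b, measurable (p2 @^-1` [set b]).
Hypothesis pw1 : forall a, m1 (p1 @^-1` [set a]) = (w1 a)%:E.
Hypothesis pw2 : forall b, m2 (p2 @^-1` [set b]) = (w2 b)%:E.

Let p12 (z : U1 * U2) := (p1 z.1, p2 z.2).

Let p12E ab : p12 @^-1` [set ab] = p1 @^-1` [set ab.1] `*` p2 @^-1` [set ab.2].
Proof.
by case: ab => a b; apply/seteqP; split=> -[x y]; [case=> <- <-|move=> [/= <- <-]].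
Qed.

Let mp12 ab : measurable (p12 @^-1` [set ab]).
Proof. by rewrite p12E; exact: measurableX. Qed.

Lemma weight_cells : (forall a, 0 < w1 a) -> weight w1.
Proof.
move=> w0; split=> //.
have i1 : m1.-integrable setT (EFin \o cst (1 : R)).
  apply: (@bounded_integrable _ _ _ m1 (cst 1) 1) => //; first exact: probability_setT.
  by move=> x /=; rewrite normr1.
have := Rintegral_partition mp1 i1.
have -> : \int[m1]_x (cst (1 : R) x) = 1.
  rewrite Rintegral_cst// mul1r -[RHS]/(fine 1%E); congr fine.
  exact: probability_setT.
move=> ->; apply: eq_bigr => a _.
rewrite Rintegral_cst// mul1r -[LHS]/(fine (w1 a)%:E); congr fine.
exact/esym/pw1.
Qed.

Lemma integral_cells (f : U1 * U2 -> R) :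
  (m1 \x m2)%E.-integrable setT (EFin \o f) ->
  \int[(m1 \x m2)%E]_z f z =
  \sum_a \sum_b \int[(m1 \x m2)%E]_(z in p1 @^-1` [set a] `*` p2 @^-1` [set b]) f z.
Proof.
move=> mf; rewrite (Rintegral_partition mp12 mf) pair_big.
by apply: eq_bigr => -[a b] _; rewrite p12E.
Qed.

Lemma measurable_step (h : I1 -> I2 -> R) :
  measurable_fun setT (fun z : U1 * U2 => h (p1 z.1) (p2 z.2)).
Proof. exact: (measurable_fun_finite (fun ab => h ab.1 ab.2) mp12). Qed.

Lemma integrable_step (h : I1 -> I2 -> R) :
  (m1 \x m2)%E.-integrable setT (EFin \o (fun z : U1 * U2 => h (p1 z.1) (p2 z.2))).
Proof.
apply: (@bounded_integrable _ _ _ _ _ (\sum_a \sum_b `|h a b|)).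
- exact: product_setT.
- exact: measurable_step.
- move=> z.
  rewrite (bigD1 (p1 z.1))//= (bigD1 (p2 z.2))//= -addrA lerDl addr_ge0// sumr_ge0//.
  by move=> i _; rewrite sumr_ge0.
Qed.

Lemma integral_step (h : I1 -> I2 -> R) :
  \int[(m1 \x m2)%E]_z h (p1 z.1) (p2 z.2) = avg w1 (fun a => avg w2 (h a)).
Proof.
rewrite (integral_cells (integrable_step h)).
apply: eq_bigr => a _; rewrite mulr_sumr; apply: eq_bigr => b _.
transitivity (\int[(m1 \x m2)%E]_(z in p1 @^-1` [set a] `*` p2 @^-1` [set b]) h a b).
  by apply: eq_Rintegral => -[x y]; rewrite inE => -[/= -> ->].
rewrite Rintegral_cst; last exact: measurableX.
transitivity (h a b * fine ((w1 a)%:E * (w2 b)%:E)%E); last by rewrite /=; ring.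
congr (_ * fine _); transitivity (m1 (p1 @^-1` [set a]) * m2 (p2 @^-1` [set b]))%E.
  exact: product_measure1E.
by congr (_ * _)%E; [exact: pw1|exact: pw2].
Qed.

End cells.

(** The competitor [g] may violate its constraint on null cylinders, so the last clause bounds
    relaxed values. Its cell averages satisfy the finite constraint for every triple of cells and
    have the same value as [g]. *)
Lemma discretize (R : realType) d1 d2 d3 (U1 : measurableType d1)
    (U2 : measurableType d2) (U3 : measurableType d3)
    (m1 : probability U1 R) (m2 : probability U2 R) (m3 : probability U3 R)
    (I1 I2 I3 : finType) (p1 : U1 -> I1) (p2 : U2 -> I2) (p3 : U3 -> I3)
    (w1 : I1 -> R) (w2 : I2 -> R) (w3 : I3 -> R) (C : I1 -> I2 -> I3 -> R) (M t : R) :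
  (forall a, measurable (p1 @^-1` [set a])) ->
  (forall a, measurable (p2 @^-1` [set a])) ->
  (forall a, measurable (p3 @^-1` [set a])) ->
  (forall a, 0 < w1 a) -> (forall a, 0 < w2 a) -> (forall a, 0 < w3 a) ->
  (forall a, m1 (p1 @^-1` [set a]) = (w1 a)%:E) ->
  (forall a, m2 (p2 @^-1` [set a]) = (w2 a)%:E) ->
  (forall a, m3 (p3 @^-1` [set a]) = (w3 a)%:E) ->
  (forall a b c, 0 <= C a b c <= M) -> 0 < M -> 0 < t ->
  exists f12 f13 f23, [/\ fadm C f12 f13 f23,
   [/\ forall a b, - 17 * M <= f12 a b <= 40 / 3 * M,
       forall a c, - 17 * M <= f13 a c <= 40 / 3 * M &
       forall b c, - 17 * M <= f23 b c <= 40 / 3 * M] &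
   forall g12 g13 g23 Y12 Y13 Y23,
  (m1 \x m2)%E.-integrable setT (EFin \o g12) ->
  (m1 \x m3)%E.-integrable setT (EFin \o g13) ->
  (m2 \x m3)%E.-integrable setT (EFin \o g23) ->
  measurable Y12 -> measurable Y13 -> measurable Y23 ->
  (m1 \x m2)%E Y12 = 0%E -> (m1 \x m3)%E Y13 = 0%E -> (m2 \x m3)%E Y23 = 0%E ->
  (forall x, ~ Y12 (pr12 x) -> ~ Y13 (pr13 x) -> ~ Y23 (pr23 x) ->
     g12 (pr12 x) + g13 (pr13 x) + g23 (pr23 x) <= C (p1 x.1.1) (p2 x.1.2) (p3 x.2)) ->
  \int[(m1 \x m2)%E]_z g12 z + \int[(m1 \x m3)%E]_z g13 z + \int[(m2 \x m3)%E]_z g23 z <=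
  \int[(m1 \x m2)%E]_z f12 (p1 z.1) (p2 z.2) +
  \int[(m1 \x m3)%E]_z f13 (p1 z.1) (p3 z.2) +
  \int[(m2 \x m3)%E]_z f23 (p2 z.1) (p3 z.2) + t].
Proof.
move=> mp1 mp2 mp3 w10 w20 w30 pw1 pw2 pw3 CM M0 t0.
have W1 := weight_cells mp1 pw1 w10.
have W2 := weight_cells mp2 pw2 w20.
have W3 := weight_cells mp3 pw3 w30.
have [f12 [f13 [f23 [[adm opt] bnd]]]] := finite_bounded W1 W2 W3 CM M0 t0.
exists f12, f13, f23; split=> //.
move=> g12 g13 g23 Y12 Y13 Y23 i12 i13 i23 mY12 mY13 mY23 Y120 Y130 Y230 gC.
rewrite (integral_step mp1 mp2 pw1 pw2) (integral_step mp1 mp3 pw1 pw3)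
  (integral_step mp2 mp3 pw2 pw3).
pose G12 a b := (w1 a * w2 b)^-1 *
  \int[(m1 \x m2)%E]_(z in p1 @^-1` [set a] `*` p2 @^-1` [set b]) g12 z.
pose G13 a b := (w1 a * w3 b)^-1 *
  \int[(m1 \x m3)%E]_(z in p1 @^-1` [set a] `*` p3 @^-1` [set b]) g13 z.
pose G23 a b := (w2 a * w3 b)^-1 *
  \int[(m2 \x m3)%E]_(z in p2 @^-1` [set a] `*` p3 @^-1` [set b]) g23 z.
have Gadm : fadm C G12 G13 G23.
  move=> a b c.
  apply: (cell_average_le i12 i13 i23 mY12 mY13 mY23 Y120 Y130 Y230
    (mp1 a) (mp2 b) (mp3 c)) => // x /= pa pb pc y12 y13 y23.
  by rewrite -pa -pb -pc; exact: gC.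
apply: le_trans (opt _ _ _ Gadm).
rewrite le_eqVlt /fval; apply/orP; left; apply/eqP; congr (_ + _ + _).
- rewrite (integral_cells mp1 mp2 i12); apply: eq_bigr => a _.
  rewrite mulr_sumr; apply: eq_bigr => b _.
  by rewrite mulrA mulVKf// mulf_neq0 ?gt_eqF.
- rewrite (integral_cells mp1 mp3 i13); apply: eq_bigr => a _.
  rewrite mulr_sumr; apply: eq_bigr => b _.
  by rewrite mulrA mulVKf// mulf_neq0 ?gt_eqF.
- rewrite (integral_cells mp2 mp3 i23); apply: eq_bigr => a _.
  rewrite mulr_sumr; apply: eq_bigr => b _.
  by rewrite mulrA mulVKf// mulf_neq0 ?gt_eqF.
Qed.

(** * Almost everywhere limits of near-minimizers *)

(** The projection argument of Hilbert spaces, reduced to what it uses: [Q] is the squared norm, [D]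
    the squared distance, [mid] the midpoint, and the hypothesis on [D] is the parallelogram law.
    The infima of [Q] over [K n] increase to a finite limit [s]. *)
Lemma near_minimizers_cauchy (R : realType) (X : Type) (K : nat -> X -> Prop)
    (Q : X -> R) (D : X -> X -> R) (mid : X -> X -> X) (q : nat -> R) :
  (forall n m x, (n <= m)%N -> K m x -> K n x) ->
  (forall n, exists x, K n x) ->
  (forall n x y, K n x -> K n y -> K n (mid x y)) ->
  (forall x, 0 <= Q x) -> (exists B, forall n x, K n x -> Q x <= B) ->
  (forall x y, K 0%N x -> K 0%N y -> D x y = 2 * Q x + 2 * Q y - 4 * Q (mid x y)) ->
  (forall n, 0 < q n) -> (forall n, q n.+1 <= q n) ->
  exists h : nat -> X, forall n, K n (h n) /\ D (h n) (h n.+1) <= q n.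
Proof.
move=> Kdec Kne Kmid Q0 [B QB] DE q0 qdec.
pose S n := [set Q x | x in K n].
have S_inf n : has_inf (S n).
  have [x Kx] := Kne n; split; first by exists (Q x), x.
  by exists 0 => _ [y _ <-].
pose a n := inf (S n).
have aQ n x : K n x -> a n <= Q x by move=> Kx; apply: ge_inf; [case: (S_inf n)|exists x].
have a_ndec n m : (n <= m)%N -> a n <= a m.
  move=> nm; apply: lb_le_inf; first by case: (S_inf m).
  by move=> _ [x Kx <-]; apply: aQ; exact: Kdec Kx.
have supa : has_sup (range a).
  split; first by exists (a 0%N), 0%N.
  exists B => _ [n _ <-]; have [x Kx] := Kne n.
  exact: le_trans (aQ _ _ Kx) (QB _ _ Kx).
pose s := sup (range a).
have as_ n : a n <= s by apply: sup_upper_bound => //; exists n.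
(* With error [q n / 8] on each of the three values of [Q], the parallelogram law gives
   [D <= q n / 4 + q n / 4 + q n / 2]. *)
have q8 n : 0 < q n / 8 by rewrite divr_gt0.
have ex_N n : exists N, s - q n / 8 < a N.
  by have [_ [N _ <-]] := sup_adherent (q8 n) supa; exists N.
have [N hN] := choice ex_N.
(* A nondecreasing majorant of both [N n] and [n]: then [h n] and [h n.+1] both lie in [K (N' n)],
   and [h n] lies in [K n]. *)
pose N' n := (n + \sum_(i < n.+1) N i)%N.
have NN' n : (N n <= N' n)%N by rewrite /N' big_ord_recr/= addnA leq_addl.
have nN' n : (n <= N' n)%N by rewrite leq_addr.
have N'S n : (N' n <= N' n.+1)%N.
  by rewrite /N' [X in (_ <= _ + X)%N]big_ord_recr/= addSn leqW// leq_add2l leq_addr.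
have ex_h n : exists x, K (N' n) x /\ Q x <= s + q n / 8.
  have [_ [x Kx <-] Qx] := inf_adherent (q8 n) (S_inf (N' n)).
  by exists x; split=> //; apply: (le_trans (ltW Qx)); rewrite lerD2r; exact: as_.
have [h hh] := choice ex_h.
exists h => n; split; first exact: Kdec (hh n).1.
rewrite DE; try by apply: Kdec (hh _).1.
have : a (N n) <= Q (mid (h n) (h n.+1)).
  apply: le_trans (a_ndec _ _ (NN' n)) _; apply: aQ; apply: Kmid; first exact: (hh n).1.
  exact: Kdec (N'S n) (hh n.+1).1.
have := (hh n).2; have := (hh n.+1).2; have := hN n; have := qdec n; lra.
Qed.

Lemma bounded_variation_cvg (R : realType) (u : nat -> R) :
  (\sum_(0 <= i <oo) `|u i.+1 - u i|%:E < +oo)%E -> cvgn u.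
Proof.
move=> H.
have nn n : (0 <= n)%N -> true -> (0 <= `|u n.+1 - u n|%:E)%E by rewrite lee_fin.
have /normed_cvg : cvgn [normed series (telescope u)].
  apply: nondecreasing_is_cvgn.
    by apply/nondecreasing_seqP => n; rewrite /= !seriesEnat/= big_nat_recr//= lerDl.
  exists (fine (\sum_(0 <= i <oo) `|u i.+1 - u i|%:E)) => _ [n _ <-].
  rewrite -lee_fin fineK; last by rewrite ge0_fin_numE// nneseries_ge0.
  by rewrite /= seriesEnat/= -sumEFin; exact: (nneseries_lim_ge n nn).
move=> cs; have -> : u = (fun n => u 0%N + series (telescope u) n).
  by apply/funext => n; exact: eq_sum_telescope.
by apply: is_cvgD => //; exact: is_cvg_cst.
Qed.

(** Squared L2 increments of size [4^-(n+1)] give L1 increments of size [2^-(n+1)]. Their sum is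
    integrable, hence finite off a null set, and there the sequence has bounded variation. *)
Lemma fast_cauchy_limit (R : realType) d (T : measurableType d)
    (m : measure T R) (f : nat -> T -> R) (lo hi : R) :
  m setT = 1%E -> lo <= hi ->
  (forall n, measurable_fun setT (f n)) ->
  (forall n x, lo <= f n x <= hi) ->
  (forall n, \int[m]_x ((f n x - f n.+1 x) ^+ 2) <= (1 / (2 ^ n.+1)%:R) ^+ 2) ->
  exists Y g, [/\ measurable Y /\ m Y = 0%E, measurable_fun setT g,
    forall x, lo <= g x <= hi, forall x, ~ Y x -> f n x @[n --> \oo] --> g x &
    \int[m]_x f n x @[n --> \oo] --> \int[m]_x g x].
Proof.
move=> mT lohi mf fB fq.
pose q n : R := 1 / (2 ^ n.+1)%:R.
have q0 n : 0 < q n by rewrite divr_gt0// ltr0n expn_gt0.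
pose v n x := f n x - f n.+1 x.
have mv n : measurable_fun setT (v n) by exact: measurable_funB.
have vB n x : `|v n x| <= hi - lo.
  rewrite ler_norml /v; have := fB n x; have := fB n.+1 x; lra.
pose u n x := `|f n.+1 x - f n x|.
have uE n x : u n x = `|v n x| by rewrite /u /v distrC.
have u0 n x : 0 <= u n x by exact: normr_ge0.
have mu_ n : measurable_fun setT (u n).
  apply: measurableT_comp => //; exact: measurable_funB.
have iu n : m.-integrable setT (EFin \o u n).
  apply: (bounded_integrable mT (mu_ n) (B := hi - lo)) => x.
  by rewrite uE normr_id.
have iv2 n : m.-integrable setT (EFin \o (fun x => (v n x) ^+ 2)).
  apply: (bounded_integrable mT (measurable_funX 2 (mv n)) (B := (hi - lo) ^+ 2)) => x.
  by rewrite normrX lerXn2r ?nnegrE// subr_ge0.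
have icst (k : R) : m.-integrable setT (EFin \o cst k).
  exact: (bounded_integrable mT (measurable_cst k) (B := `|k|)).
have iu_le n : \int[m]_x u n x <= q n.
  (* AM-GM: [|v| <= v^2 / (2 q) + q / 2] *)
  pose w x := (2 * q n)^-1 * (v n x) ^+ 2 + cst (q n / 2) x.
  have iw1 : m.-integrable setT (EFin \o (fun x => (2 * q n)^-1 * (v n x) ^+ 2)).
    by have := integrableZl measurableT (2 * q n)^-1 (iv2 n); exact: eq_integrable.
  have iw : m.-integrable setT (EFin \o w).
    by have := integrableD measurableT iw1 (icst (q n / 2)); exact: eq_integrable.
  apply: (@le_trans _ _ (\int[m]_x w x)).
    apply: le_Rintegral => // x _; rewrite uE /w.
    rewrite -(real_normK (num_real (v n x))) -(ler_pM2l (q0 n)) mulrDr mulrA.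
    have -> : q n * (2 * q n)^-1 = 1 / 2 by field; rewrite gt_eqF.
    have := sqr_ge0 (`|v n x| - q n); rewrite sqrrB /=; nra.
  rewrite RintegralD// RintegralZl// Rintegral_cst// mT mulr1.
  have : (2 * q n)^-1 * \int[m]_x (v n x) ^+ 2 <= (2 * q n)^-1 * q n ^+ 2.
    by rewrite ler_wpM2l ?invr_ge0 ?mulr_ge0 ?(ltW (q0 n))//; exact: fq.
  have -> : (2 * q n)^-1 * q n ^+ 2 = q n / 2 by field; rewrite gt_eqF.
  lra.
have mEu n : measurable_fun setT (fun x => (u n x)%:E) by exact/measurable_EFinP.
have u0E n x : (0 <= (u n x)%:E)%E by rewrite lee_fin; exact: u0.
pose S x := (\sum_(0 <= n <oo) (u n x)%:E)%E.
have mS : measurable_fun setT S.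
  apply: (@ge0_emeasurable_sum _ _ _ setT (fun n x => (u n x)%:E) xpredT) => [k x _ _|k _]; first by rewrite lee_fin; exact: u0.
  exact/measurable_EFinP.
have S0 x : (0 <= S x)%E by apply: nneseries_ge0 => n _ _; rewrite lee_fin; exact: u0.
have iS : m.-integrable setT S.
  apply/integrableP; split=> //.
  under eq_integral => x _ do rewrite gee0_abs//.
  rewrite (integral_nneseries m measurableT mEu (fun n x _ => u0E n x)).
  apply: (@le_lt_trans _ _ 1%E); last exact: ltry.
  apply: le_trans (epsilon_trick0 xpredT (@ler01 R)).
  apply: lee_nneseries => [n _ _|n _]; first by apply: integral_ge0 => x _; rewrite lee_fin; exact: u0.
  by rewrite RintegralE// lee_fin; exact: iu_le.
pose Y := S @^-1` [set +oo%E].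
have mY : measurable Y by rewrite -[Y]setTI; apply: mS.
have Y0 : m Y = 0%E.
  apply/negligibleP => //; apply: negligibleS (integrable_ae measurableT iS).
  by move=> x /= Yx /(_ Logic.I); rewrite Yx.
(* On the null set [Y] the value is reset to [lo], so that the limit exists at every point, is
   measurable, and obeys the bounds everywhere. *)
pose f' n x := if x \in Y then lo else f n x.
pose g x := if x \in Y then lo else limn (f ^~ x).
have cf x : ~ Y x -> cvgn (f ^~ x).
  move=> Yx; apply: bounded_variation_cvg; rewrite ltey; exact/eqP.
have f'g x : f' n x @[n --> \oo] --> g x.
  rewrite /f' /g; case: ifPn => [_|]; first exact: cvg_cst.
  by rewrite notin_setE; exact: cf.
have mf' n : measurable_fun setT (f' n).
  apply: measurable_fun_ifT => //.
  apply: (@measurable_fun_bool _ _ _ _ true); rewrite setTI.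
  by rewrite [X in measurable X](_ : _ = Y)//; apply/seteqP; split=> x; [exact: set_mem|exact: mem_set].
have mg : measurable_fun setT g by apply: (measurable_fun_cvg mf') => x _; exact: f'g.
have f'B n x : lo <= f' n x <= hi by rewrite /f'; case: ifP => // _; rewrite lexx.
have gB x : lo <= g x <= hi.
  apply/andP; split.
    apply: (ler_cvg_to (@cvg_cst _ lo _ \oo _) (f'g x)); apply: nearW => n.
    by case/andP: (f'B n x).
  apply: (ler_cvg_to (f'g x) (@cvg_cst _ hi _ \oo _)); apply: nearW => n.
  by case/andP: (f'B n x).
have fg x : ~ Y x -> f n x @[n --> \oo] --> g x.
  move=> Yx; have -> : g x = limn (f ^~ x) by rewrite /g ifF//; apply/negbTE; rewrite notin_setE.
  exact: cf.
exists Y, g; split=> //.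
have Babs x : lo <= x <= hi -> `|x| <= `|lo| + `|hi|.
  move=> /andP[lx xh]; rewrite ler_norml; have := ler_norm hi; have := ler_norm (- lo).
  rewrite normrN; have := normr_ge0 hi; have := normr_ge0 lo; lra.
have ifn n : m.-integrable setT (EFin \o f n).
  by apply: (bounded_integrable mT (mf n)) => x; exact: Babs (fB n x).
have ig : m.-integrable setT (EFin \o g).
  by apply: (bounded_integrable mT mg) => x; exact: Babs (gB x).
have fgae : {ae m, forall x, setT x -> (f n x)%:E @[n --> \oo] --> (EFin \o g) x}.
  exists Y; split=> // x /= /not_implyP[_ nfx]; apply: contrapT => Yx; apply: nfx.
  by apply: cvg_EFin; [exact: nearW|exact: fg].
have fdom : {ae m, forall x n, setT x ->
    (`|(f n x)%:E| <= (EFin \o cst (`|lo| + `|hi|)%R) x)%E}.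
  by apply: aeW => x n _; rewrite lee_fin; exact: Babs (fB n x).
have [_ _] := dominated_convergence measurableT (fun n => measurable_int _ (ifn n))
  (measurable_int _ ig) fgae (icst _) fdom.
by rewrite [X in _ --> X](RintegralE ig) => /fine_cvg.
Qed.

(** * Bounded measurable functions and the parallelogram law *)

Section bounded_functions.
Context (R : realType) d (T : measurableType d) (m : measure T R) (lo hi : R).
Hypothesis mT : m setT = 1%E.

(** The bounds hold at every point, as the theorem requires, and not just almost everywhere. *)
Definition bounded_meas (f : T -> R) :=
  measurable_fun setT f /\ forall x, lo <= f x <= hi.

Lemma bounded_meas_integrable f :
  bounded_meas f -> m.-integrable setT (EFin \o f).
Proof.
move=> [mf fB]; apply: (bounded_integrable mT mf (B := `|lo| + `|hi|)) => x.
have := fB x; rewrite ler_norml; have := ler_norm hi; have := ler_norm (- lo).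
rewrite normrN; have := normr_ge0 hi; have := normr_ge0 lo; lra.
Qed.

Lemma bounded_meas_sqr_integrable f :
  bounded_meas f -> m.-integrable setT (EFin \o (fun x => f x ^+ 2)).
Proof.
move=> [mf fB].
apply: (bounded_integrable mT (measurable_funX 2 mf) (B := (`|lo| + `|hi|) ^+ 2)) => x.
rewrite normrX lerXn2r ?nnegrE// ?addr_ge0//.
have := fB x; rewrite ler_norml; have := ler_norm hi; have := ler_norm (- lo).
rewrite normrN; have := normr_ge0 hi; have := normr_ge0 lo; lra.
Qed.

Definition midf (f g : T -> R) (x : T) := (f x + g x) / 2.

Lemma bounded_meas_mid f g :
  bounded_meas f -> bounded_meas g -> bounded_meas (midf f g).
Proof.
move=> [mf fB] [mg gB]; split; last first.
  by move=> x; have := fB x; have := gB x; rewrite /midf; lra.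
by apply: measurable_funM => //; exact: measurable_funD.
Qed.

Lemma integral_mid f g : bounded_meas f -> bounded_meas g ->
  \int[m]_x midf f g x = (\int[m]_x f x + \int[m]_x g x) / 2.
Proof.
move=> bf bg; have fi := bounded_meas_integrable bf.
have gi := bounded_meas_integrable bg.
rewrite -RintegralD// mulrC -RintegralZl//.
  by apply: eq_Rintegral => x _; rewrite /midf mulrC.
by have := integrableD measurableT fi gi; exact: eq_integrable.
Qed.

Lemma parallelogram f g : bounded_meas f -> bounded_meas g ->
  \int[m]_x (f x - g x) ^+ 2 =
  2 * \int[m]_x f x ^+ 2 + 2 * \int[m]_x g x ^+ 2 - 4 * \int[m]_x midf f g x ^+ 2.
Proof.
move=> bf bg; have fi := bounded_meas_sqr_integrable bf.
have gi := bounded_meas_sqr_integrable bg.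
have hi' := bounded_meas_sqr_integrable (bounded_meas_mid bf bg).
have zi (k : R) h : m.-integrable setT (EFin \o h) ->
    m.-integrable setT (EFin \o (fun x => k * h x)).
  by move=> ih; have := integrableZl measurableT k ih; exact: eq_integrable.
rewrite -!RintegralZl// -RintegralD//; try exact: zi.
rewrite -RintegralB//; try exact: zi.
  by apply: eq_Rintegral => x _; rewrite /midf; field.
by have := integrableD measurableT (zi 2 _ fi) (zi 2 _ gi); exact: eq_integrable.
Qed.

Lemma sqr_integral_le f : bounded_meas f ->
  0 <= \int[m]_x f x ^+ 2 <= (`|lo| + `|hi|) ^+ 2.
Proof.
move=> bf; apply/andP; split; first by apply: Rintegral_ge0 => x _; exact: sqr_ge0.
have ic : m.-integrable setT (EFin \o cst ((`|lo| + `|hi|) ^+ 2)).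
  by apply: (bounded_integrable mT (measurable_cst _) (B := `|(`|lo| + `|hi|) ^+ 2|)).
rewrite -[leRHS]mulr1 -[X in _ * X]/(fine 1%E) -mT -(Rintegral_cst _ measurableT).
apply: le_Rintegral => //; first exact: bounded_meas_sqr_integrable.
move=> x _ /=; rewrite -(real_normK (num_real (f x))) lerXn2r ?nnegrE ?addr_ge0//.
have := bf.2 x; rewrite ler_norml; have := ler_norm hi; have := ler_norm (- lo).
rewrite normrN; have := normr_ge0 hi; have := normr_ge0 lo; lra.
Qed.

End bounded_functions.

(** * Properties that hold up to zero thickness *)

Section thick_ae.
Context (R : realType) d1 d2 d3 (U1 : measurableType d1) (U2 : measurableType d2)
  (U3 : measurableType d3)
  (m1 : probability U1 R) (m2 : probability U2 R) (m3 : probability U3 R).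

(** The exceptional set is the whole union of the three null cylinders, which is measurable even if
    the set where [P] fails is not. *)
Definition thick_ae (P : U1 * U2 * U3 -> Prop) := exists Y12 Y13 Y23,
  [/\ measurable Y12 /\ (m1 \x m2)%E Y12 = 0%E,
      measurable Y13 /\ (m1 \x m3)%E Y13 = 0%E,
      measurable Y23 /\ (m2 \x m3)%E Y23 = 0%E &
      forall x, ~ Y12 (pr12 x) -> ~ Y13 (pr13 x) -> ~ Y23 (pr23 x) -> P x].

Lemma thick_ae_imply (P Q : U1 * U2 * U3 -> Prop) :
  (forall x, P x -> Q x) -> thick_ae P -> thick_ae Q.
Proof.
move=> PQ [Y12 [Y13 [Y23 [h12 h13 h23 h]]]]; exists Y12, Y13, Y23; split=> //.
by move=> x y12 y13 y23; apply: PQ; exact: h.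
Qed.

Let bigcup_null d (T : measurableType d) (m : measure T R) (Y : nat -> set T) :
  (forall n, measurable (Y n) /\ m (Y n) = 0%E) ->
  measurable (\bigcup_n Y n) /\ m (\bigcup_n Y n) = 0%E.
Proof.
move=> hY; have mY : measurable (\bigcup_n Y n).
  by apply: bigcup_measurable => n _; exact: (hY n).1.
split=> //; apply/negligibleP => //; apply: negligible_bigcup => n.
by apply/negligibleP; [exact: (hY n).1|exact: (hY n).2].
Qed.

Lemma thick_ae_foralln (P : nat -> U1 * U2 * U3 -> Prop) :
  (forall n, thick_ae (P n)) -> thick_ae (fun x => forall n, P n x).
Proof.
move=> /choice[Y12] /choice[Y13] /choice[Y23] h.
exists (\bigcup_n Y12 n), (\bigcup_n Y13 n), (\bigcup_n Y23 n); split.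
- by apply: bigcup_null => n; case: (h n).
- by apply: bigcup_null => n; case: (h n).
- by apply: bigcup_null => n; case: (h n).
- move=> x y12 y13 y23 n; case: (h n) => _ _ _; apply=> y.
  + by apply: y12; exists n.
  + by apply: y13; exists n.
  + by apply: y23; exists n.
Qed.

Lemma thick_aeI (P Q : U1 * U2 * U3 -> Prop) :
  thick_ae P -> thick_ae Q -> thick_ae (fun x => P x /\ Q x).
Proof.
move=> hP hQ; have : thick_ae (fun x => forall n : nat, if n is 0%N then P x else Q x).
  by apply: thick_ae_foralln => -[|n].
by apply: thick_ae_imply => x h; split; [exact: (h 0%N)|exact: (h 1%N)].
Qed.

Lemma thick_ae_pr12 (Y : set (U1 * U2)) : measurable Y -> (m1 \x m2)%E Y = 0%E ->
  thick_ae (fun x => ~ Y (pr12 x)).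
Proof.
move=> mY Y0; exists Y, set0, set0.
by split=> //; split=> //; exact: measure0.
Qed.

Lemma thick_ae_pr13 (Y : set (U1 * U3)) : measurable Y -> (m1 \x m3)%E Y = 0%E ->
  thick_ae (fun x => ~ Y (pr13 x)).
Proof.
move=> mY Y0; exists set0, Y, set0.
by split=> //; split=> //; exact: measure0.
Qed.

Lemma thick_ae_pr23 (Y : set (U2 * U3)) : measurable Y -> (m2 \x m3)%E Y = 0%E ->
  thick_ae (fun x => ~ Y (pr23 x)).
Proof.
move=> mY Y0; exists set0, set0, Y.
by split=> //; split=> //; exact: measure0.
Qed.

(** A null set of one coordinate is a null cylinder over any pair containing that coordinate. *)
Lemma thick_ae_coord (Z1 : set U1) (Z2 : set U2) (Z3 : set U3) :
  measurable Z1 -> measurable Z2 -> measurable Z3 ->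
  m1 Z1 = 0%E -> m2 Z2 = 0%E -> m3 Z3 = 0%E ->
  thick_ae (fun x => [/\ ~ Z1 x.1.1, ~ Z2 x.1.2 & ~ Z3 x.2]).
Proof.
move=> mZ1 mZ2 mZ3 Z10 Z20 Z30.
have h1 : thick_ae (fun x => ~ (Z1 `*` setT) (pr12 x)).
  apply: thick_ae_pr12; first exact: measurableX.
  transitivity (m1 Z1 * m2 setT)%E; first exact: product_measure1E.
  by rewrite Z10 mul0e.
have h2 : thick_ae (fun x => ~ (setT `*` Z2) (pr12 x)).
  apply: thick_ae_pr12; first exact: measurableX.
  transitivity (m1 setT * m2 Z2)%E; first exact: product_measure1E.
  by rewrite Z20 mule0.
have h3 : thick_ae (fun x => ~ (setT `*` Z3) (pr13 x)).
  apply: thick_ae_pr13; first exact: measurableX.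
  transitivity (m1 setT * m3 Z3)%E; first exact: product_measure1E.
  by rewrite Z30 mule0.
apply: thick_ae_imply (thick_aeI h1 (thick_aeI h2 h3)) => x [k1 [k2 k3]].
by split=> z; [apply: k1|apply: k2|apply: k3]; split.
Qed.

Definition val3 (f : (U1 * U2 -> R) * (U1 * U3 -> R) * (U2 * U3 -> R)) : R :=
  \int[(m1 \x m2)%E]_z f.1.1 z + \int[(m1 \x m3)%E]_z f.1.2 z +
  \int[(m2 \x m3)%E]_z f.2 z.

Definition sum3 (f : (U1 * U2 -> R) * (U1 * U3 -> R) * (U2 * U3 -> R))
  (x : U1 * U2 * U3) : R := f.1.1 (pr12 x) + f.1.2 (pr13 x) + f.2 (pr23 x).

Definition bounded3 (lo hi : R)
    (f : (U1 * U2 -> R) * (U1 * U3 -> R) * (U2 * U3 -> R)) :=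
  [/\ bounded_meas lo hi f.1.1, bounded_meas lo hi f.1.2 & bounded_meas lo hi f.2].

(** The last clause says that [sum3 g] is at most the limit superior of [e k], expressed through
    eventual upper bounds [s]. In this form the constraint passes to midpoints, and weakens as the
    tail starts later. *)
Lemma bounded_tuple_limit (lo hi V : R) (e : nat -> U1 * U2 * U3 -> R)
    (f : nat -> (U1 * U2 -> R) * (U1 * U3 -> R) * (U2 * U3 -> R)) :
  lo <= hi -> (forall n, bounded3 lo hi (f n)) ->
  (forall n, V - n.+1%:R^-1 <= val3 (f n)) ->
  (forall n, thick_ae (fun x => sum3 (f n) x <= e n x)) ->
  exists g, [/\ bounded3 lo hi g, V <= val3 g &
    thick_ae (fun x => forall n s, (forall k, (n <= k)%N -> e k x <= s) ->
      sum3 g x <= s)].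
Proof.
move=> lohi fb fV fe.
have m12T := product_setT m1 m2.
have m13T := product_setT m1 m3.
have m23T := product_setT m2 m3.
(* The sets [K n] are convex and decrease with [n], so near-minimizers of the
   squared norm over [K n] form a Cauchy sequence by the parallelogram law. *)
pose X := ((U1 * U2 -> R) * (U1 * U3 -> R) * (U2 * U3 -> R))%type.
pose K n (g : X) := [/\ bounded3 lo hi g, V - n.+1%:R^-1 <= val3 g &
  thick_ae (fun x => forall s, (forall k, (n <= k)%N -> e k x <= s) -> sum3 g x <= s)].
pose Q (g : X) := \int[(m1 \x m2)%E]_z g.1.1 z ^+ 2 + \int[(m1 \x m3)%E]_z g.1.2 z ^+ 2 +
  \int[(m2 \x m3)%E]_z g.2 z ^+ 2.
pose D (g h : X) := \int[(m1 \x m2)%E]_z (g.1.1 z - h.1.1 z) ^+ 2 +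
  \int[(m1 \x m3)%E]_z (g.1.2 z - h.1.2 z) ^+ 2 +
  \int[(m2 \x m3)%E]_z (g.2 z - h.2 z) ^+ 2.
pose mid (g h : X) : X := (midf g.1.1 h.1.1, midf g.1.2 h.1.2, midf g.2 h.2).
pose q n : R := (1 / (2 ^ n.+1)%:R) ^+ 2.
have q0 n : 0 < q n by rewrite exprn_gt0// divr_gt0// ltr0n expn_gt0.
have qdec n : q n.+1 <= q n.
  rewrite /q lerXn2r ?nnegrE ?divr_ge0//.
  by rewrite ler_pM2l// lef_pV2 ?posrE ?ltr0n ?expn_gt0// ler_nat leq_exp2l.
have [] := @near_minimizers_cauchy R X K Q D mid q _ _ _ _ _ _ q0 qdec.
- move=> n p g np [bg gV ge]; split=> //.
    apply: le_trans gV; rewrite lerD2l lerN2 lef_pV2 ?posrE ?ltr0n//.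
    by rewrite ler_nat.
  apply: thick_ae_imply ge => x h s hs; apply: h => k pk; apply: hs.
  exact: leq_trans pk.
- move=> n; exists (f n); split=> //.
  apply: thick_ae_imply (fe n) => x fx s hs; apply: le_trans fx _; exact: hs.
- move=> n g h [[bg1 bg2 bg3] gV ge] [[bh1 bh2 bh3] hV he]; split.
  + by split; exact: bounded_meas_mid.
  + have -> : val3 (mid g h) = (val3 g + val3 h) / 2.
      rewrite /val3 /= (integral_mid m12T bg1 bh1) (integral_mid m13T bg2 bh2).
      by rewrite (integral_mid m23T bg3 bh3); field.
    by move: gV hV; move: (V - _) => b; lra.
  + apply: thick_ae_imply (thick_aeI ge he) => x [gx hx] s hs.
    have := gx s hs; have := hx s hs; rewrite /sum3 /= /midf; lra.
- by move=> g; rewrite /Q !addr_ge0//; apply: Rintegral_ge0 => x _; exact: sqr_ge0.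
- exists (3 * (`|lo| + `|hi|) ^+ 2) => n g [[b1 b2 b3] _ _]; rewrite /Q.
  have /andP[_ h1] := sqr_integral_le m12T b1.
  have /andP[_ h2] := sqr_integral_le m13T b2.
  have /andP[_ h3] := sqr_integral_le m23T b3.
  by apply: le_trans (lerD (lerD h1 h2) h3) _; rewrite le_eqVlt; apply/orP; left; apply/eqP; ring.
- move=> g h [[bg1 bg2 bg3] _ _] [[bh1 bh2 bh3] _ _].
  rewrite /D /Q (parallelogram m12T bg1 bh1) (parallelogram m13T bg2 bh2)
    (parallelogram m23T bg3 bh3) /=; ring.
move=> h hK.
have sq0 d (T : measurableType d) (m : measure T R) (k : T -> R) :
    0 <= \int[m]_z k z ^+ 2.
  by apply: Rintegral_ge0 => x _; exact: sqr_ge0.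
have b12 n : bounded_meas lo hi (h n).1.1 by case: (hK n) => -[[]].
have b13 n : bounded_meas lo hi (h n).1.2 by case: (hK n) => -[[]].
have b23 n : bounded_meas lo hi (h n).2 by case: (hK n) => -[[]].
(* [D] is a sum of three integrals of squares, so its bound controls each component separately. *)
have [Y12 [g12 [[mY12 Y120] mg12 bg12 cg12 ig12]]] := fast_cauchy_limit
  m12T lohi (fun n => (b12 n).1) (fun n => (b12 n).2) (fun n =>
   le_trans (ler_wpDr (sq0 _ _ _ _) (ler_wpDr (sq0 _ _ _ _) (lexx _))) (hK n).2).
have [Y13 [g13 [[mY13 Y130] mg13 bg13 cg13 ig13]]] := fast_cauchy_limit
  m13T lohi (fun n => (b13 n).1) (fun n => (b13 n).2) (fun n =>
   le_trans (ler_wpDr (sq0 _ _ _ _) (ler_wpDl (sq0 _ _ _ _) (lexx _))) (hK n).2).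
have [Y23 [g23 [[mY23 Y230] mg23 bg23 cg23 ig23]]] := fast_cauchy_limit
  m23T lohi (fun n => (b23 n).1) (fun n => (b23 n).2) (fun n =>
   le_trans (ler_wpDl (addr_ge0 (sq0 _ _ _ _) (sq0 _ _ _ _)) (lexx _)) (hK n).2).
exists (g12, g13, g23); split.
- by split.
- have Vc : V - (n.+1%:R^-1 : R) @[n --> \oo] --> V - 0.
    by apply: cvgB; [exact: cvg_cst|exact: cvg_harmonic].
  rewrite -[V]subr0; apply: (ler_cvg_to Vc (cvgD (cvgD ig12 ig13) ig23)).
  by apply: nearW => n; case: (hK n) => -[].
- have hall : thick_ae (fun x => forall n s, (forall k, (n <= k)%N -> e k x <= s) ->
      sum3 (h n) x <= s).
    by apply: thick_ae_foralln => n; case: (hK n) => -[].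
  apply: thick_ae_imply (thick_aeI hall (thick_aeI (thick_ae_pr12 mY12 Y120)
    (thick_aeI (thick_ae_pr13 mY13 Y130) (thick_ae_pr23 mY23 Y230)))).
  move=> x [hx [y12 [y13 y23]]] n s hs.
  apply: (ler_cvg_to (cvgD (cvgD (cg12 _ y12) (cg13 _ y13)) (cg23 _ y23)) (@cvg_cst _ s _ \oo _)).
  exists n => // p /= np; apply: (hx p s) => k pk; apply: hs; exact: leq_trans pk.
Qed.

End thick_ae.

(** * Partitions of separable metric spaces *)

(** The finite problem needs positive weights, so the cells of zero mass, collected in [null_part],
    are merged into another cell. [tail_part] has small measure, and no diameter is controlled on
    it. *)
Record cell_map (R : realType) (U : Type) := CellMap {
  cell_index : finType;
  cell_of : U -> cell_index;
  cell_weight : cell_index -> R;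
  null_part : set U;
  tail_part : set U }.

Arguments cell_of {R U} c _.
Arguments cell_weight {R U} c _.

Definition fine_cell_map (R : realType) d (U : measurableType d)
    (mu : probability U R) (dist : U -> U -> R) (delta eta : R)
    (D : cell_map R U) : Prop :=
  [/\ forall a, measurable (cell_of D @^-1` [set a]),
      forall a, 0 < cell_weight D a /\ mu (cell_of D @^-1` [set a]) = (cell_weight D a)%:E,
      measurable (null_part D) /\ mu (null_part D) = 0%E,
      measurable (tail_part D) /\ (mu (tail_part D) <= eta%:E)%E &
      forall x y, ~ null_part D x -> ~ null_part D y -> ~ tail_part D x ->
        cell_of D x = cell_of D y -> dist x y < delta].

Section fine_cell_map_exists.
Context (R : realType) d (U : measurableType d) (mu : probability U R)
  (dist : U -> U -> R) (q : nat -> U).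
Hypothesis dist_sym : forall x y, dist x y = dist y x.
Hypothesis dist_tri : forall x y z, dist x z <= dist x y + dist y z.
Hypothesis q_dense : forall x r, 0 < r -> exists n, dist (q n) x < r.
Hypothesis ball_meas : forall n r, measurable [set y | dist (q n) y < r].

(** A point is sent to the index [r x] of the first ball of radius [delta / 2] around the dense
    sequence that contains it. The sets where [r x < n] exhaust the space, so some [N] leaves
    measure less than [eta]. *)
Lemma fine_cell_map_exists (delta eta : R) : 0 < delta -> 0 < eta ->
  exists D, fine_cell_map mu dist delta eta D.
Proof.
move=> delta0 eta0.
pose B n := [set y | dist (q n) y < delta / 2].
have delta2 : 0 < delta / 2 by rewrite divr_gt0.
have exB x : exists n, `[< B n x >].
  by have [n nx] := q_dense x delta2; exists n; apply/asboolP.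
pose r x := ex_minn (exB x).
have rB x : B (r x) x by rewrite /r; case: ex_minnP => n /asboolP.
have r_min x n : B n x -> (r x <= n)%N.
  by rewrite /r; case: ex_minnP => k _ + /asboolP; apply.
pose F n := \bigcup_(k < n) B k.
have mF n : measurable (F n) by apply: bigcup_measurable => k _; exact: ball_meas.
have FE n x : F n x <-> (r x < n)%N.
  split=> [[k /= kn /r_min]|rn]; first by move/leq_ltn_trans; exact.
  by exists (r x).
have F_cvg : mu (F n) @[n --> \oo] --> 1%E.
  have <- : mu (\bigcup_n F n) = 1%E.
    have -> : \bigcup_n F n = setT.
      by apply/seteqP; split=> // x _; exists (r x).+1 => //; apply/FE.
    exact: probability_setT.
  apply: nondecreasing_cvg_mu => //; first by apply: bigcup_measurable => n _.
  move=> n m nm; apply/subsetPset => x /FE rn; apply/FE; exact: leq_trans nm.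
have [N FN] : exists N, ((1 - eta)%:E < mu (F N))%E.
  apply: contrapT => /forallNP H.
  have : (limn (mu \o F) <= (1 - eta)%:E)%E.
    apply: lime_le; first by apply/cvg_ex; exists 1%E.
    by apply: nearW => n /=; rewrite leNgt; apply/negP/H.
  rewrite (cvg_lim _ F_cvg)//; apply/negP; rewrite -ltNge lte_fin; lra.
(* Indices are truncated at [N]; the last cell [N] is the tail. *)
pose p0 x : 'I_N.+1 := inord (minn (r x) N).
have p0E x : p0 x = minn (r x) N :> nat by rewrite inordK// ltnS geq_minr.
have mr n : measurable [set x | r x = n].
  have -> : [set x | r x = n] = F n.+1 `\` F n.
    apply/seteqP; split=> x /=.
      by move=> rx; split; [apply/FE; rewrite rx|move/FE; rewrite rx ltnn].
    move=> [/FE rn /FE nr]; apply/eqP; rewrite eqn_leq -ltnS rn/= leqNgt.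
    exact/negP.
  exact: measurableD.
have mp0 a : measurable (p0 @^-1` [set a]).
  have [aN|aN] := eqVneq (val a) N.
    have -> : p0 @^-1` [set a] = ~` F N.
      apply/seteqP; split=> x /=.
        move=> px; move/FE => rx; move: (p0E x); rewrite px aN => /esym/minn_idPr.
        by rewrite leqNgt rx.
      move=> Fx; apply/val_inj; rewrite /= p0E aN; apply/minn_idPr.
      by rewrite leqNgt; apply/negP => /FE.
    exact: measurableC.
  have -> : p0 @^-1` [set a] = [set x | r x = a].
    have aN' : (a < N)%N by rewrite ltn_neqAle aN -ltnS /=; exact: ltn_ord.
    apply/seteqP; split=> x /=.
      move=> px; have := p0E x; rewrite px /minn; case: ifP => // _ e.
      by move: aN; rewrite /= e eqxx.
    by move=> rx; apply/val_inj; rewrite /= p0E rx; apply/minn_idPl; exact: ltnW.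
  exact: mr.
pose w0 a := fine (mu (p0 @^-1` [set a])).
have w0E a : mu (p0 @^-1` [set a]) = (w0 a)%:E.
  rewrite /w0 fineK// ge0_fin_numE//; apply: (@le_lt_trans _ _ 1%E); last exact: ltry.
  exact: probability_le1.
pose I := {a : 'I_N.+1 | 0 < w0 a}.
pose Z := [set x | ~~ (0 < w0 (p0 x))].
have ZE : Z = \bigcup_(a in [set a | ~~ (0 < w0 a)]) (p0 @^-1` [set a]).
  by apply/seteqP; split=> x /=; [move=> ?; exists (p0 x)|move=> [a /= wa pa]; rewrite /Z /= pa].
have mZ : measurable Z.
  by rewrite ZE; apply: fin_bigcup_measurable => //; exact: finite_finset.
have Z0 : mu Z = 0%E.
  apply/negligibleP => //.
  apply: (negligibleS (A := \bigcup_n (if (n < N.+1)%N && ~~ (0 < w0 (inord n))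
      then p0 @^-1` [set inord n] else set0))).
    by move=> x Zx; exists (p0 x) => //; rewrite ltn_ord inord_val Zx.
  apply: negligible_bigcup => n; case: ifPn => [/andP[_ wn]|_]; last exact: negligible_set0.
  apply/negligibleP; first exact: mp0.
  have w_ge0 : 0 <= w0 (inord n) by rewrite /w0 fine_ge0.
  rewrite -[RHS]/((0 : R)%:E); transitivity (w0 (inord n))%:E; first exact: w0E.
  by congr EFin; apply/eqP; rewrite eq_le w_ge0 leNgt wn.
have [x0 nZx0] : exists x, ~ Z x.
  apply: contrapT => /forallNP H.
  have ZT : Z = setT by apply/seteqP; split=> // x _; apply: contrapT; exact: H.
  have : mu setT = 0%E by rewrite -ZT.
  have -> : mu setT = 1%E by exact: probability_setT.
  by move/eqP; rewrite onee_eq0.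
have w00 : 0 < w0 (p0 x0) by apply/negP => /negP.
pose a0 : I := exist _ (p0 x0) w00.
(* The default [a0] absorbs all points of the null set [Z], which changes no mass. *)
pose p x : I := insubd a0 (p0 x).
have pE x : ~ Z x -> val (p x) = p0 x.
  by move=> /negP; rewrite negbK => h; rewrite insubdK.
have pZ x : Z x -> p x = a0.
  by move=> Zx; rewrite /p /insubd insubN.
have pcell a : p @^-1` [set a] =
    (p0 @^-1` [set val a]) `|` (if a == a0 then Z else set0).
  apply/seteqP; split=> x /=.
    move=> px; have [Zx|nZx] := pselect (Z x).
      by right; rewrite -px pZ// eqxx.
    by left; rewrite -pE// px.
  case=> [px|].
    apply/val_inj; rewrite pE ?px// => Zx.
    by move: Zx; rewrite /Z/= px => /negP; apply; exact: (svalP a).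
  by case: eqP => // -> Zx; exact: pZ.
have mif a : measurable (if a == a0 then Z else set0) by case: ifP.
have mif0 a : mu (if a == a0 then Z else set0) = 0%E.
  by case: ifP => _; [exact: Z0|exact: measure0].
exists (CellMap p (fun a => w0 (val a)) Z (~` F N)); split=> /=.
- by move=> a; rewrite pcell; apply: measurableU; [exact: mp0|exact: mif].
- move=> a; split; first exact: (svalP a).
  rewrite pcell; transitivity (mu (p0 @^-1` [set val a])); last exact: w0E.
  by apply: measureU0; [exact: mp0|exact: mif|exact: mif0].
- by split.
- split; first exact: measurableC.
  rewrite probability_setC//; have := FN.
  have -> : mu (F N) = (fine (mu (F N)))%:E.
    rewrite fineK// ge0_fin_numE//; apply: (@le_lt_trans _ _ 1%E); last exact: ltry.
    exact: probability_le1.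
  by rewrite lte_fin -EFinB lee_fin; lra.
- move=> x y nZx nZy Fx pxy.
  have p0xy : p0 x = p0 y by rewrite -(pE x)// -(pE y)// pxy.
  have rx : (r x < N)%N by apply: contrapT => h; apply: Fx => /FE.
  have rxy : r x = r y.
    have := p0E x; rewrite p0xy p0E (minn_idPl (ltnW rx)) /minn.
    by case: ifP => // _ e; rewrite e ltnn in rx.
  have := rB x; have := rB y; rewrite -rxy /B /= => h1 h2.
  have := dist_tri x (q (r x)) y; rewrite (dist_sym x (q _)); lra.
Qed.

End fine_cell_map_exists.

(** * Existence of bounded maximizers *)

(** The Borel-Cantelli lemma: the tails have summable measures, so almost every point lies in only
    finitely many of them. *)
Lemma tail_parts_null (R : realType) d (U : measurableType d) (mu : probability U R)
    (Z T : nat -> set U) :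
  (forall k, measurable (Z k) /\ mu (Z k) = 0%E) ->
  (forall k, measurable (T k) /\ (mu (T k) <= (1 / (2 ^ k.+1)%:R)%:E)%E) ->
  exists N, [/\ measurable N, mu N = 0%E & forall x, ~ N x ->
    (forall k, ~ Z k x) /\ exists n, forall k, (n <= k)%N -> ~ T k x].
Proof.
move=> hZ hT.
have L0 : mu (lim_sup_set T) = 0%E.
  apply: lim_sup_set_cvg0; first by move=> k; case: (hT k).
  apply: (@le_lt_trans _ _ 1%E); last exact: ltry.
  apply: le_trans (epsilon_trick0 xpredT (@ler01 R)).
  by apply: lee_nneseries => k *; [exact: measure_ge0|case: (hT k)].
have mL : measurable (lim_sup_set T).
  apply: bigcap_measurable; first by exists 0%N.
  by move=> n _; apply: bigcup_measurable => k _; case: (hT k).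
have mZ : measurable (\bigcup_k Z k) by apply: bigcup_measurable => k _; case: (hZ k).
have Z0 : mu (\bigcup_k Z k) = 0%E.
  apply/negligibleP => //; apply: negligible_bigcup => k.
  by apply/negligibleP; [exact: (hZ k).1|exact: (hZ k).2].
exists (lim_sup_set T `|` \bigcup_k Z k); split; first exact: measurableU.
  transitivity (mu (lim_sup_set T)); last exact: L0.
  by apply: measureU0; [exact: mL|exact: mZ|exact: Z0].
move=> x /not_orP[xL xZ]; split; first by move=> k Zk; apply: xZ; exists k.
move: xL => /existsNP[n /not_implyP[_ xT]]; exists n => k nk Tk; apply: xT.
by exists k.
Qed.

Section attainment.
Context (R : realType) d1 d2 d3 (U1 : measurableType d1) (U2 : measurableType d2)
  (U3 : measurableType d3)
  (m1 : probability U1 R) (m2 : probability U2 R) (m3 : probability U3 R).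

Definition integrable3 (f : (U1 * U2 -> R) * (U1 * U3 -> R) * (U2 * U3 -> R)) :=
  [/\ (m1 \x m2)%E.-integrable setT (EFin \o f.1.1),
      (m1 \x m3)%E.-integrable setT (EFin \o f.1.2) &
      (m2 \x m3)%E.-integrable setT (EFin \o f.2)].

(** Serves the degenerate case [supnorm c = 0]. *)
Lemma val3_le_cst f (C : R) : integrable3 f ->
  thick_ae m1 m2 m3 (fun x => sum3 f x <= C) -> val3 m1 m2 m3 f <= C.
Proof.
move=> [i12 i13 i23] [Y12 [Y13 [Y23 [[? ?] [? ?] [? ?] H]]]].
exact: (sum_integral_le i12 i13 i23 (Y12 := Y12) (Y13 := Y13) (Y23 := Y23)).
Qed.

(* [C] is the supremum of [c] over the cells of positive measure; [0] is thrown
   in so that the bounds on [C] need no nonemptiness argument. *)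
Lemma discretized_near_optimal (c : U1 * U2 * U3 -> R) (M t : R)
    (dist1 : U1 -> U1 -> R) (dist2 : U2 -> U2 -> R) (dist3 : U3 -> U3 -> R)
    (delta eta : R) D1 D2 D3 :
  (forall x, 0 <= c x <= M) -> 0 < M -> 0 < t ->
  fine_cell_map m1 dist1 delta eta D1 -> fine_cell_map m2 dist2 delta eta D2 ->
  fine_cell_map m3 dist3 delta eta D3 ->
  exists (f : (U1 * U2 -> R) * (U1 * U3 -> R) * (U2 * U3 -> R))
         (e : U1 * U2 * U3 -> R),
   [/\ bounded3 (- 17 * M) (40 / 3 * M) f,
       forall x, sum3 f x <= e x,
       forall x s, 0 <= s ->
         ~ null_part D1 x.1.1 -> ~ null_part D2 x.1.2 -> ~ null_part D3 x.2 ->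
         ~ tail_part D1 x.1.1 -> ~ tail_part D2 x.1.2 -> ~ tail_part D3 x.2 ->
         (forall y, dist1 x.1.1 y.1.1 < delta -> dist2 x.1.2 y.1.2 < delta ->
            dist3 x.2 y.2 < delta -> c y <= s) -> e x <= s &
       forall g, integrable3 g -> thick_ae m1 m2 m3 (fun x => sum3 g x <= c x) ->
         val3 m1 m2 m3 g <= val3 m1 m2 m3 f + t].
Proof.
move=> cM M0 t0 [mp1 w1 [mZ1 Z10] [mT1 T1] D1d] [mp2 w2 [mZ2 Z20] [mT2 T2] D2d].
move=> [mp3 w3 [mZ3 Z30] [mT3 T3] D3d].
pose p (x : U1 * U2 * U3) := (cell_of D1 x.1.1, cell_of D2 x.1.2, cell_of D3 x.2).
pose good (y : U1 * U2 * U3) :=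
  [/\ ~ null_part D1 y.1.1, ~ null_part D2 y.1.2 & ~ null_part D3 y.2].
pose S a1 a2 a3 := [set 0] `|` [set c y | y in [set y | good y /\ p y = (a1, a2, a3)]].
pose C a1 a2 a3 := sup (S a1 a2 a3).
have S_ub a1 a2 a3 : ubound (S a1 a2 a3) M.
  by move=> _ [->|[y _ <-]]; [exact: ltW|case/andP: (cM y)].
have CM a1 a2 a3 : 0 <= C a1 a2 a3 <= M.
  apply/andP; split; last by apply: ge_sup; [exists 0; left|exact: S_ub].
  by apply: ub_le_sup; [exists M; exact: S_ub|left].
have [f12 [f13 [f23 [adm [b12 b13 b23] opt]]]] := discretize mp1 mp2 mp3
  (fun a => (w1 a).1) (fun a => (w2 a).1) (fun a => (w3 a).1)
  (fun a => (w1 a).2) (fun a => (w2 a).2) (fun a => (w3 a).2) CM M0 t0.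
exists (fun z => f12 (cell_of D1 z.1) (cell_of D2 z.2),
        fun z => f13 (cell_of D1 z.1) (cell_of D3 z.2),
        fun z => f23 (cell_of D2 z.1) (cell_of D3 z.2)).
exists (fun x => C (cell_of D1 x.1.1) (cell_of D2 x.1.2) (cell_of D3 x.2)); split.
- by split; split => //=; exact: measurable_step.
- by move=> x; exact: adm.
- move=> x s s0 z1 z2 z3 t1 t2 t3 xs; apply: ge_sup; first by exists 0; left.
  move=> _ [->//|[y [[y1 y2 y3] [p1 p2 p3]] <-]].
  by apply: xs; [exact: D1d|exact: D2d|exact: D3d].
- move=> g [i12 i13 i23] gc.
  (* [C] is known to dominate [c] only off the null parts, so these join the exceptional set of [g]
     as null cylinders. *)
  have [Y12 [Y13 [Y23 [[mY12 Y120] [mY13 Y130] [mY23 Y230] H]]]] :=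
    thick_aeI gc (thick_ae_coord mZ1 mZ2 mZ3 Z10 Z20 Z30).
  apply: (opt g.1.1 g.1.2 g.2 Y12 Y13 Y23) => // x y12 y13 y23.
  have [gx gd] := H x y12 y13 y23; apply: le_trans gx _.
  by apply: ub_le_sup; [exists M; exact: S_ub|right; exists x].
Qed.

Lemma bounded_maximizer (c : U1 * U2 * U3 -> R) (M : R)
    (dist1 : U1 -> U1 -> R) (dist2 : U2 -> U2 -> R) (dist3 : U3 -> U3 -> R) :
  (forall x, 0 <= c x <= M) -> 0 < M ->
  (forall x e, 0 < e -> exists2 delta, 0 < delta & forall y,
     dist1 x.1.1 y.1.1 < delta -> dist2 x.1.2 y.1.2 < delta ->
     dist3 x.2 y.2 < delta -> c y <= c x + e) ->
  (forall delta eta, 0 < delta -> 0 < eta ->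
     exists D, fine_cell_map m1 dist1 delta eta D) ->
  (forall delta eta, 0 < delta -> 0 < eta ->
     exists D, fine_cell_map m2 dist2 delta eta D) ->
  (forall delta eta, 0 < delta -> 0 < eta ->
     exists D, fine_cell_map m3 dist3 delta eta D) ->
  exists f, [/\ bounded3 (- 17 * M) (40 / 3 * M) f,
    thick_ae m1 m2 m3 (fun x => sum3 f x <= c x) &
    forall g, integrable3 g -> thick_ae m1 m2 m3 (fun x => sum3 g x <= c x) ->
      val3 m1 m2 m3 g <= val3 m1 m2 m3 f].
Proof.
move=> cM M0 c_usc ex1 ex2 ex3.
(* [delta k] is both mesh and tolerance and only has to tend to 0; [eta k] has to be summable for
   Borel-Cantelli. *)
pose delta k : R := k.+1%:R^-1.
pose eta k : R := 1 / (2 ^ k.+1)%:R.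
have delta0 k : 0 < delta k by rewrite invr_gt0 ltr0n.
have eta0 k : 0 < eta k by rewrite divr_gt0// ltr0n expn_gt0.
have [D1 hD1] := choice (fun k => ex1 _ _ (delta0 k) (eta0 k)).
have [D2 hD2] := choice (fun k => ex2 _ _ (delta0 k) (eta0 k)).
have [D3 hD3] := choice (fun k => ex3 _ _ (delta0 k) (eta0 k)).
have [f /choice[e fe]] := choice (fun k =>
  discretized_near_optimal cM M0 (delta0 k) (hD1 k) (hD2 k) (hD3 k)).
pose S := [set v | exists g, [/\ integrable3 g,
  thick_ae m1 m2 m3 (fun x => sum3 g x <= c x) & v = val3 m1 m2 m3 g]].
have Sf k v : S v -> v <= val3 m1 m2 m3 (f k) + delta k.
  by move=> [g [ig gc ->]]; case: (fe k) => _ _ _; apply.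
have S_ub : has_ubound S.
  by exists (val3 m1 m2 m3 (f 0%N) + delta 0%N) => v; exact: Sf.
have icst0 d (T : measurableType d) (m : measure T R) :
    m.-integrable setT (EFin \o cst (0 : R)).
  by apply: eq_integrable (integrable0 m setT) => // x _.
have S0 : S !=set0.
  exists (val3 m1 m2 m3 (cst 0, cst 0, cst 0)); eexists; split; last by [].
    by split; exact: icst0.
  exists set0, set0, set0; split; try by split=> //; exact: measure0.
  by move=> x _ _ _; rewrite /sum3 /= !addr0; case/andP: (cM x).
have lohi : - 17 * M <= 40 / 3 * M by lra.
have fb k : bounded3 (- 17 * M) (40 / 3 * M) (f k) by case: (fe k).
have fV k : sup S - k.+1%:R^-1 <= val3 m1 m2 m3 (f k).
  by rewrite lerBlDr; apply: ge_sup => // v; exact: Sf.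
have fle k : thick_ae m1 m2 m3 (fun x => sum3 (f k) x <= e k x).
  exists set0, set0, set0; split; try by split=> //; exact: measure0.
  by move=> x _ _ _; case: (fe k).
have [g [bg Vg gc]] := bounded_tuple_limit lohi fb fV fle.
exists g; split=> //; last first.
  by move=> h ih hc; apply: le_trans Vg; apply: ub_le_sup => //; exists h.
have [N1 [mN1 N10 hN1]] := @tail_parts_null _ _ _ m1 (fun k => null_part (D1 k))
  (fun k => tail_part (D1 k)) (fun k => let: And5 _ _ h _ _ := hD1 k in h)
  (fun k => let: And5 _ _ _ h _ := hD1 k in h).
have [N2 [mN2 N20 hN2]] := @tail_parts_null _ _ _ m2 (fun k => null_part (D2 k))
  (fun k => tail_part (D2 k)) (fun k => let: And5 _ _ h _ _ := hD2 k in h)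
  (fun k => let: And5 _ _ _ h _ := hD2 k in h).
have [N3 [mN3 N30 hN3]] := @tail_parts_null _ _ _ m3 (fun k => null_part (D3 k))
  (fun k => tail_part (D3 k)) (fun k => let: And5 _ _ h _ _ := hD3 k in h)
  (fun k => let: And5 _ _ _ h _ := hD3 k in h).
apply: thick_ae_imply (thick_aeI gc (thick_ae_coord mN1 mN2 mN3 N10 N20 N30)).
move=> x [gx [/hN1[z1 [n1 t1]] /hN2[z2 [n2 t2]] /hN3[z3 [n3 t3]]]].
apply/ler_addgt0Pr => eps eps0.
have [dl dl0 hdl] := c_usc x eps eps0.
have [n0 n0dl] : exists n, forall k, (n <= k)%N -> delta k <= dl.
  exists (Num.truncn dl^-1) => k nk.
  rewrite /delta -[leRHS]invrK lef_pV2 ?posrE ?invr_gt0 ?ltr0n//.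
  by apply: ltW; apply: lt_le_trans (truncnS_gt _) _; rewrite ler_nat ltnS.
(* From this rank on, [x] has left the three tails and the mesh is below the radius [dl], so [c] is
   at most [c x + eps] on the cell of [x], null parts excluded. *)
apply: (gx (maxn n0 (maxn n1 (maxn n2 n3)))) => k.
rewrite !geq_max => /and4P[k0 k1 k2 k3].
case: (fe k) => _ _ + _; apply.
- by rewrite addr_ge0 ?(ltW eps0)//; case/andP: (cM x).
- exact: z1.
- exact: z2.
- exact: z3.
- exact: t1.
- exact: t2.
- exact: t3.
- by move=> y y1 y2 y3; apply: hdl; apply: lt_le_trans (n0dl _ k0).
Qed.

End attainment.

(** * Polish spaces and the two dual problems *)

Lemma polish_metric (R : realType) (T : ptopologicalType) : polish R T ->
  exists dist : T -> T -> R,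
  [/\ forall x A, nbhs x A -> exists2 e, 0 < e & [set y | dist x y < e] `<=` A &
      forall (mu : probability (borel T) R) delta eta, 0 < delta -> 0 < eta ->
        exists D, fine_cell_map mu dist delta eta D].
Proof.
move=> [[dist [d0 dsym dtri dopen _]] [D [/countable_injP[f finj] dD]]].
have dxx x : dist x x = 0 by apply/(d0 x x).2.
have ball_open x r : open [set y | dist x y < r].
  apply/dopen => y /= xy; exists (r - dist x y); first by rewrite subr_gt0.
  by move=> z /= yz; have := dtri x y z; lra.
exists dist; split.
  move=> x A; rewrite nbhsE => -[B [oB Bx] BA].
  have [e e0 eB] := (dopen B).1 oB x Bx; exists e => //.
  exact: subset_trans BA.
move=> mu delta eta delta0 eta0.
(* Inverts the injection [f] of the countable dense set into [nat]; numbers not attained are sent to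
   the default [point]. *)
pose q n := xget point [set x | D x /\ f x = n].
apply: (@fine_cell_map_exists R _ (borel T) mu dist q) => //.
- move=> x r r0.
  have /dD := ball_open x r; case; first by exists x; rewrite /= dxx.
  move=> y [xy Dy]; exists (f y); suff -> : q (f y) = y by rewrite dsym.
  rewrite /q; case: xgetP => [z _ [Dz fz]|/(_ y)]; last by case.
  by apply: finj => //; rewrite inE.
- move=> n r; apply: sub_sigma_algebra; exact: ball_open.
Qed.

Lemma continuous_near3 (R : realType) (T1 T2 T3 : ptopologicalType)
    (c : T1 * T2 * T3 -> R) (dist1 : T1 -> T1 -> R) (dist2 : T2 -> T2 -> R)
    (dist3 : T3 -> T3 -> R) :
  continuous c ->
  (forall x A, nbhs x A -> exists2 e, 0 < e & [set y | dist1 x y < e] `<=` A) ->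
  (forall x A, nbhs x A -> exists2 e, 0 < e & [set y | dist2 x y < e] `<=` A) ->
  (forall x A, nbhs x A -> exists2 e, 0 < e & [set y | dist3 x y < e] `<=` A) ->
  forall x e, 0 < e -> exists2 delta, 0 < delta & forall y,
    dist1 x.1.1 y.1.1 < delta -> dist2 x.1.2 y.1.2 < delta ->
    dist3 x.2 y.2 < delta -> c y <= c x + e.
Proof.
move=> c_cont h1 h2 h3 x e e0.
have cx : c x < c x + e by rewrite ltrDl.
have [[A12 A3] /= [[[A1 A2] /= [nA1 nA2] sA12] nA3] sA] := cvgr_le _ (c_cont x) _ cx.
have [r1 r10 s1] := h1 _ _ nA1.
have [r2 r20 s2] := h2 _ _ nA2.
have [r3 r30 s3] := h3 _ _ nA3.
exists (Num.min r1 (Num.min r2 r3)); first by rewrite !lt_min r10 r20 r30.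
move=> y; rewrite !lt_min => /and3P[y1 _ _] /and3P[_ y2 _] /and3P[_ _ y3].
by apply: (sA y); split => /=; [apply: sA12; split; [exact: s1|exact: s2]|exact: s3].
Qed.

Section relaxed_problem.
Context (R : realType) (T1 T2 T3 : ptopologicalType)
  (mu1 : probability (borel T1) R) (mu2 : probability (borel T2) R)
  (mu3 : probability (borel T3) R) (c : T1 * T2 * T3 -> R).

(** [zero_thickness] asks for a measurable set; the union of the null cylinders provides one. *)
Lemma relaxed_admissibleP (f : dual_tuple R T1 T2 T3) :
  relaxed_admissible mu1 mu2 mu3 c f <->
  integrable3 mu1 mu2 mu3 f /\ thick_ae mu1 mu2 mu3 (fun x => sum3 f x <= c x).
Proof.
split=> -[i3 H]; split=> //.
  case: H => N [[mN [Y12 [Y13 [Y23 [h12 h13 h23 NY]]]]] fN].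
  exists Y12, Y13, Y23; split=> // x y12 y13 y23; apply: fN => /NY /=.
  by case=> [|[]].
case: H => Y12 [Y13 [Y23 [[m12 z12] [m13 z13] [m23 z23] fY]]].
exists [set x | Y12 (pr12 x) \/ Y13 (pr13 x) \/ Y23 (pr23 x)].
split; last first.
  by move=> x /not_orP[y12 /not_orP[y13 y23]]; exact: fY.
split; last by exists Y12, Y13, Y23; split.
have mN12 : measurable [set x : XX T1 T2 T3 | Y12 (pr12 x)].
  by rewrite -[X in measurable X]setTI; exact: measurable_pr12.
have mN13 : measurable [set x : XX T1 T2 T3 | Y13 (pr13 x)].
  by rewrite -[X in measurable X]setTI; exact: measurable_pr13.
have mN23 : measurable [set x : XX T1 T2 T3 | Y23 (pr23 x)].
  by rewrite -[X in measurable X]setTI; exact: measurable_pr23.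
exact: measurableU mN12 (measurableU _ _ mN13 mN23).
Qed.

Lemma dual_valueE (f : dual_tuple R T1 T2 T3) : integrable3 mu1 mu2 mu3 f ->
  dual_value mu1 mu2 mu3 f = (val3 mu1 mu2 mu3 f)%:E.
Proof.
by move=> [i12 i13 i23]; rewrite /val3 !EFinD -!RintegralE.
Qed.

Lemma bounded3_integrable (lo hi : R) (f : dual_tuple R T1 T2 T3) :
  bounded3 lo hi f -> integrable3 mu1 mu2 mu3 f.
Proof.
move=> [b12 b13 b23]; split.
- exact: (bounded_meas_integrable (product_setT mu1 mu2) b12).
- exact: (bounded_meas_integrable (product_setT mu1 mu3) b13).
- exact: (bounded_meas_integrable (product_setT mu2 mu3) b23).
Qed.

Lemma bounded_relaxed_solution : polish R T1 -> polish R T2 -> polish R T3 ->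
  (forall x, 0 <= c x) -> (exists M : R, forall x, `|c x| <= M) -> continuous c ->
  exists f : dual_tuple R T1 T2 T3,
    relaxed_solution mu1 mu2 mu3 c f /\
    bounded3 (- 17 * supnorm c) (40 / 3 * supnorm c) f.
Proof.
move=> hP1 hP2 hP3 c0 [B cB] c_cont.
have c_le x : 0 <= c x <= supnorm c.
  rewrite c0 /=; apply: le_trans (ler_norm _) _.
  by apply: ub_le_sup; [exists B => _ [y _ <-]|exists x].
suff [f [bf fc fmax]] : exists f, [/\ bounded3 (- 17 * supnorm c) (40 / 3 * supnorm c) f,
    thick_ae mu1 mu2 mu3 (fun x => sum3 f x <= c x) &
    forall g, integrable3 mu1 mu2 mu3 g ->
      thick_ae mu1 mu2 mu3 (fun x => sum3 g x <= c x) ->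
      val3 mu1 mu2 mu3 g <= val3 mu1 mu2 mu3 f].
  have fi := bounded3_integrable bf.
  exists f; split=> //; split; first exact/relaxed_admissibleP.
  move=> g /relaxed_admissibleP[gi gc].
  by rewrite !dual_valueE// lee_fin; exact: fmax.
have M0 : 0 <= supnorm c by have /andP[] := c_le point; exact: le_trans.
(* The finite problem measures its tolerance in units of [M] and needs [M > 0]. If the supremum is
   0, then [c = 0] and the zero tuple is optimal. *)
have [M_eq0|M_neq0] := eqVneq (supnorm c) 0; last first.
  have [dist1 [nb1 ex1]] := polish_metric hP1.
  have [dist2 [nb2 ex2]] := polish_metric hP2.
  have [dist3 [nb3 ex3]] := polish_metric hP3.
  apply: (@bounded_maximizer _ _ _ _ _ _ _ mu1 mu2 mu3 c (supnorm c) dist1 dist2 dist3) => //.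
  - by rewrite lt_neqAle eq_sym M_neq0.
  - exact: continuous_near3.
  - exact: ex1.
  - exact: ex2.
  - exact: ex3.
have cE x : c x = 0.
  by apply/eqP; rewrite eq_le c0 andbT -M_eq0; case/andP: (c_le x).
have bz : bounded3 0 0 (cst 0, cst 0, cst 0 : borel T2 * borel T3 -> R).
  by split; split => //= x; rewrite lexx.
exists (cst 0, cst 0, cst 0); split.
- by rewrite M_eq0 !mulr0.
- exists set0, set0, set0; split; try by split=> //; exact: measure0.
  by move=> x _ _ _; rewrite /sum3 /= !addr0.
- move=> g gi gc; have -> : val3 mu1 mu2 mu3 (cst 0, cst 0, cst 0) = 0.
    by rewrite /val3 /= !Rintegral_cst//= !mul0r !addr0.
  apply: val3_le_cst => //; apply: thick_ae_imply gc => x; by rewrite cE.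
Qed.

(* Lowering [f] to [lo] on the exceptional null sets makes the constraint hold
   there, since the two other terms are at most [hi] and [c] is nonnegative. *)
Lemma relaxed_to_standard (lo hi : R) (f : dual_tuple R T1 T2 T3) :
  (forall x, 0 <= c x) -> lo + hi + hi <= 0 -> lo <= hi ->
  relaxed_solution mu1 mu2 mu3 c f -> bounded3 lo hi f ->
  exists g, std_solution mu1 mu2 mu3 c g /\ bounded3 lo hi g.
Proof.
move=> c0 lohi2 lohi [/relaxed_admissibleP[fi fc] fmax] [b12 b13 b23].
have [Y12 [Y13 [Y23 [[m12 z12] [m13 z13] [m23 z23] fY]]]] := fc.
have patch d (T : measurableType d) (m : measure T R) (Y : set T) (h : T -> R) :
    measurable Y -> m Y = 0%E -> bounded_meas lo hi h ->
    bounded_meas lo hi (fun x => if x \in Y then lo else h x) /\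
    \int[m]_x (if x \in Y then lo else h x) = \int[m]_x h x.
  move=> mY Y0 [mh hB].
  have mg : measurable_fun setT (fun x => if x \in Y then lo else h x).
    apply: measurable_fun_ifT => //.
    apply: (@measurable_fun_bool _ _ _ _ true); rewrite setTI.
    by rewrite [X in measurable X](_ : _ = Y)//; apply/seteqP; split=> x; [exact: set_mem|exact: mem_set].
  split; first by split=> // x; case: ifP => // _; rewrite lexx.
  congr fine; apply: ae_eq_integral => //; try exact/measurable_EFinP.
  exists Y; split=> // x /= /not_implyP[_ hx]; apply: contrapT => Yx; apply: hx.
  by rewrite ifF//; apply/negbTE; rewrite notin_setE.
have [g12 v12] := patch _ _ (mu1 \x mu2)%E _ _ m12 z12 b12.
have [g13 v13] := patch _ _ (mu1 \x mu3)%E _ _ m13 z13 b13.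
have [g23 v23] := patch _ _ (mu2 \x mu3)%E _ _ m23 z23 b23.
pose g : dual_tuple R T1 T2 T3 := (fun x => if x \in Y12 then lo else f.1.1 x,
  fun x => if x \in Y13 then lo else f.1.2 x, fun x => if x \in Y23 then lo else f.2 x).
have bg : bounded3 lo hi g by [].
have gi := bounded3_integrable bg.
have vg : val3 mu1 mu2 mu3 g = val3 mu1 mu2 mu3 f by rewrite /val3 /= v12 v13 v23.
exists g; split=> //; split; last first.
  (* A standard competitor is also a relaxed one, so it cannot beat [f], whose value the patched
     tuple keeps. *)
  move=> h [hi' hc]; rewrite (dual_valueE gi) vg -dual_valueE//; apply: fmax.
  apply/relaxed_admissibleP; split=> //.
  exists set0, set0, set0; split; try by split=> //; exact: measure0.
  by move=> x _ _ _; exact: hc.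
split=> // x; rewrite /tuple_sum -/(pr12 x) -/(pr13 x) -/(pr23 x).
have := g12.2 (pr12 x); have := g13.2 (pr13 x); have := g23.2 (pr23 x); have := c0 x.
rewrite /g /=; case: ifPn; case: ifPn; case: ifPn; try lra.
rewrite !notin_setE => y1 y2 y3 _ _ _ _; exact: fY.
Qed.

End relaxed_problem.

Lemma bounded3_tuple_bounded (R : realType) (T1 T2 T3 : ptopologicalType)
    (lo hi : R) (f : dual_tuple R T1 T2 T3) :
  bounded3 lo hi f -> tuple_bounded lo hi f.
Proof. by move=> [[_ ?] [_ ?] [_ ?]]. Qed.

Lemma bounded3_widen (R : realType) d1 d2 d3 (U1 : measurableType d1)
    (U2 : measurableType d2) (U3 : measurableType d3) (lo lo' hi : R)
    (f : (U1 * U2 -> R) * (U1 * U3 -> R) * (U2 * U3 -> R)) :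
  lo' <= lo -> bounded3 lo hi f -> bounded3 lo' hi f.
Proof.
move=> ll [[m1 b1] [m2 b2] [m3 b3]]; split; split=> // x.
- by have /andP[b ->] := b1 x; rewrite (le_trans ll b).
- by have /andP[b ->] := b2 x; rewrite (le_trans ll b).
- by have /andP[b ->] := b3 x; rewrite (le_trans ll b).
Qed.

Theorem mainTheorem16 (R : realType) (T1 T2 T3 : ptopologicalType)
  (hP1 : polish R T1) (hP2 : polish R T2) (hP3 : polish R T3)
  (mu1 : probability (borel T1) R) (mu2 : probability (borel T2) R)
  (mu3 : probability (borel T3) R)
  (c : T1 * T2 * T3 -> R)
  (c_ge0 : forall x, 0 <= c x)
  (c_bounded : exists M : R, forall x, `|c x| <= M)
  (c_cont : continuous c) :
  (exists f, relaxed_solution mu1 mu2 mu3 c f /\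
     tuple_bounded (- 17 * supnorm c) (40 / 3 * supnorm c) f) /\
  (exists f, std_solution mu1 mu2 mu3 c f /\
     tuple_bounded (- (80 / 3) * supnorm c) (40 / 3 * supnorm c) f).
Proof.
have [f [fsol bf]] := bounded_relaxed_solution mu1 mu2 mu3 hP1 hP2 hP3 c_ge0 c_bounded c_cont.
have M0 : 0 <= supnorm c.
  have [B cB] := c_bounded; apply: le_trans (normr_ge0 (c point)) _.
  by apply: ub_le_sup; [exists B => _ [y _ <-]|exists point].
split; first by exists f; split=> //; exact: bounded3_tuple_bounded.
(* The value [- 80 / 3] is minus twice [40 / 3]: one lowered term outweighs two terms at their upper
   bound. *)
have bf' : bounded3 (- (80 / 3) * supnorm c) (40 / 3 * supnorm c) f.
  by apply: bounded3_widen bf; lra.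
have [||g [gsol bg]] := relaxed_to_standard c_ge0 _ _ fsol bf'; [lra|lra|].
by exists g; split=> //; exact: bounded3_tuple_bounded.
Qed.
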